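(* Let $n\geq 2$ and let $1\leq h\leq p^{n-1}-1$ be primitive. Let $\sigma_1,\sigma_2:\mathbf{Q}_p^\times\to E^\times$ be smooth characters with $\sigma_1(p)=\sigma_2(p)$ and let $\sigma=\sigma_1\otimes\sigma_2$. Then the representation $\Pi_n(h,\sigma)$ of $\mathrm{B}$ is irreducible.
   Context: $p$ is a prime, $E$ a finite extension of $\mathbf{F}_p$. $\mathrm{B}$ is the group of invertible upper triangular $2\times2$ matrices over $\mathbf{Q}_p$, $\mathrm{K}=\left\{\begin{pmatrix} a & b\\ 0 & d\end{pmatrix}: a,d\in\mathbf{Z}_p^\times, b\in\mathbf{Z}_p\right\}$, $\mathrm{Z}$ the center of $\mathrm{B}$. For $\sigma=\sigma_1\otimes\sigma_2$ the character $\begin{pmatrix} a & b\\ 0 & d\end{pmatrix}\mapsto\sigma_1(a)\sigma_2(d)$ of $\mathrm{K}\mathrm{Z}$, $\operatorname{ind}_{\mathrm{K}\mathrm{Z}}^{\mathrm{B}}\sigma$ is the space of $f:\mathrm{B}\to E$ with $f(kg)=\sigma(k)f(g)$ ($k\in \mathrm{K}\mathrm{Z}$), compactly supported modulo $\mathrm{Z}$, with $(gf)(h)=f(hg)$. For $g\in\mathrm{B}$, $[g]$ is the function with $[g](h)=\sigma(hg)$ if $h\in\mathrm{K}\mathrm{Z}g^{-1}$ and $0$ otherwise. Binomial coefficients $\binom{j}{\ell}$ are defined by $(1+X)^j=\sum_\ell\binom{j}{\ell}X^\ell$ and viewed in $\mathbf{F}_p\subset E$. For $n\geq1$, $0\leq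 \ell\leq p^n-1$, put $w_{\ell,n}=\sum_{j=0}^{p^n-1}\binom{j}{\ell}\left[\begin{pmatrix}1 & -jp^{-n}\\ 0 & 1\end{pmatrix}\right]$. If $\sigma_1(p)=\sigma_2(p)=:\lambda$, $n\ge 2$ and $1\leq h\leq p^{n-1}-1$, then $S_n(h,\sigma)$ is the subspace of $\operatorname{ind}_{\mathrm{K}\mathrm{Z}}^{\mathrm{B}}\sigma$ spanned by the $\mathrm{B}$-translates of $(-\lambda^{-1})^n\left[\begin{pmatrix}1&0\\0&p^n\end{pmatrix}\right]+w_{h(p-1),n}$, and $\Pi_n(h,\sigma)=\operatorname{ind}_{\mathrm{K}\mathrm{Z}}^{\mathrm{B}}\sigma/S_n(h,\sigma)$. An integer $1\le h\le p^n-2$ is primitive if there is no divisor $d<n$ of $n$ such that $h$ is a multiple of $(p^n-1)/(p^d-1)$. *)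

(* Defs.v *)
From HB Require Import structures.
From mathcomp Require Import all_boot all_order all_algebra all_field.
From mathcomp Require Import all_classical topology ring.

Set Implicit Arguments.
Unset Strict Implicit.
Unset Printing Implicit Defensive.

Import Order.TTheory GRing.Theory Num.Theory.
Local Open Scope classical_set_scope.
Local Open Scope ring_scope.

(* Z_p is the inverse limit of the Z/p^n: a p-adic integer is the sequence of
   its residues in {0, ..., p^n - 1}. The single equation below also bounds
   [x n], since a remainder modulo the nonzero [p ^ n] lies in this range. *)
Definition coherent (p : nat) : pred (nat -> int) :=
  fun x => `[< forall n, x n = (x n.+1 %% (p ^ n)%N%:Z)%Z >].

Record padic_int (p : nat) (p_pr : prime p) :=
  PadicInt { residue :> nat -> int; residueP : coherent p residue }.

Section PadicInt.
Variables (p : nat) (p_pr : prime p).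
Local Notation Zp := (padic_int p_pr).
Local Notation q n := (p ^ n)%N%:Z.

HB.instance Definition _ := [isSub for @residue p p_pr].
HB.instance Definition _ := [Choice of Zp by <:].

Implicit Types x y z : Zp.

Lemma eqmodz_dvd d a b : (a = b %[mod d])%Z <-> (d %| a - b)%Z.
Proof. by rewrite -eqz_mod_dvd; split => [->|/eqP]. Qed.

Lemma dvd_qq n m : (n <= m)%N -> (q n %| q m)%Z.
Proof. by move=> nm; rewrite dvdzE /= dvdn_exp2l. Qed.

Lemma q_neq0 n : q n != 0.
Proof. by rewrite -lt0n expn_gt0 prime_gt0. Qed.

Lemma residueS x n : (x n.+1 %% q n)%Z = x n.
Proof. by have /asboolP/(_ n) := residueP x. Qed.

Lemma residue_mod x n : (x n %% q n)%Z = x n.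
Proof. by rewrite -residueS modz_mod. Qed.

Lemma residue_dvd x n m : (n <= m)%N -> (q n %| x m - x n)%Z.
Proof.
elim: m => [|m IHm]; first by rewrite leqn0 => /eqP ->; rewrite subrr dvdz0.
rewrite leq_eqVlt => /predU1P[->|]; first by rewrite subrr dvdz0.
rewrite ltnS => nm; rewrite -(subrKA (x m)) rpredD ?IHm //.
apply: dvdz_trans (dvd_qq nm) _; apply/eqmodz_dvd.
by rewrite residueS residue_mod.
Qed.

Lemma padic_eqP x y : (forall n, (q n %| x n - y n)%Z) -> x = y.
Proof.
move=> xy; apply: val_inj; apply/funext => n /=.
by rewrite -residue_mod -(residue_mod y); apply/eqmodz_dvd.
Qed.

Definition compatible (u : nat -> int) := forall n, (q n %| u n.+1 - u n)%Z.

Lemma coherent_mod u : compatible u -> coherent p (fun n => (u n %% q n)%Z).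
Proof.
move=> cu; apply/asboolP => n; apply/esym/eqmodz_dvd.
rewrite -(subrKA (u n.+1)) rpredD //.
apply: dvdz_trans (dvd_qq (leqnSn n)) _; apply/eqmodz_dvd; exact: modz_mod.
Qed.

Definition plim u (cu : compatible u) : Zp := PadicInt p_pr (coherent_mod cu).

Lemma plimP u (cu : compatible u) n : (q n %| plim cu n - u n)%Z.
Proof. by apply/eqmodz_dvd; rewrite modz_mod. Qed.

Lemma compat_const c : compatible (fun=> c).
Proof. by move=> n; rewrite subrr dvdz0. Qed.

Lemma compat_add x y : compatible (fun n => x n + y n).
Proof. by move=> n; rewrite opprD addrACA rpredD //; apply: residue_dvd. Qed.

Lemma compat_opp x : compatible (fun n => - x n).
Proof. by move=> n; rewrite -opprD rpredN; apply: residue_dvd. Qed.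

Lemma dvdz_subM d a a' b b' :
  (d %| a - a')%Z -> (d %| b - b')%Z -> (d %| a * b - a' * b')%Z.
Proof.
move=> da db; rewrite -(subrKA (a' * b)) -mulrBl -mulrBr.
by apply: rpredD; [apply: dvdz_mulr|apply: dvdz_mull].
Qed.

Lemma compat_mul x y : compatible (fun n => x n * y n).
Proof. by move=> n; apply: dvdz_subM; apply: residue_dvd. Qed.

Definition padic_add x y := plim (compat_add x y).
Definition padic_opp x := plim (compat_opp x).
Definition padic_mul x y := plim (compat_mul x y).
Definition padic_const c := plim (compat_const c).

Lemma padic_addE x y n : (q n %| padic_add x y n - (x n + y n))%Z.
Proof. exact: (plimP (compat_add x y)). Qed.
Lemma padic_oppE x n : (q n %| padic_opp x n - - x n)%Z.
Proof. exact: (plimP (compat_opp x)). Qed.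
Lemma padic_mulE x y n : (q n %| padic_mul x y n - x n * y n)%Z.
Proof. exact: (plimP (compat_mul x y)). Qed.
Lemma padic_constE c n : (q n %| padic_const c n - c)%Z.
Proof. exact: (plimP (compat_const c)). Qed.

Lemma dvdz_subD d a a' b b' :
  (d %| a - a')%Z -> (d %| b - b')%Z -> (d %| a + b - (a' + b'))%Z.
Proof. by move=> da db; rewrite opprD addrACA rpredD. Qed.

Lemma dvdz_sub_trans d b a c :
  (d %| a - b)%Z -> (d %| b - c)%Z -> (d %| a - c)%Z.
Proof. by move=> da db; rewrite -(subrKA b) rpredD. Qed.

Lemma dvdz_subC d a b : (d %| a - b)%Z -> (d %| b - a)%Z.
Proof. by rewrite -opprB rpredN. Qed.

Lemma dvdz_subr d a : (d %| a - a)%Z.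
Proof. by rewrite subrr dvdz0. Qed.

Local Lemma addA : associative padic_add.
Proof.
move=> x y z; apply: padic_eqP => n.
apply: (dvdz_sub_trans (padic_addE _ _ _)).
apply: (dvdz_sub_trans (dvdz_subD (dvdz_subr _ _) (padic_addE _ _ _))).
rewrite addrA; apply: dvdz_subC.
apply: (dvdz_sub_trans (padic_addE _ _ _)).
exact: (dvdz_subD (padic_addE _ _ _) (dvdz_subr _ _)).
Qed.

Local Lemma addC : commutative padic_add.
Proof.
move=> x y; apply: padic_eqP => n.
apply: (dvdz_sub_trans (padic_addE _ _ _)); apply: dvdz_subC.
by rewrite [x n + _]addrC; apply: padic_addE.
Qed.

Local Lemma add0 : left_id (padic_const 0) padic_add.
Proof.
move=> x; apply: padic_eqP => n; apply: (dvdz_sub_trans (padic_addE _ _ _)).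
rewrite -[X in (_ %| _ - X)%Z]add0r.
exact: (dvdz_subD (padic_constE _ _) (dvdz_subr _ _)).
Qed.

Local Lemma addN : left_inverse (padic_const 0) padic_opp padic_add.
Proof.
move=> x; apply: padic_eqP => n; apply: (dvdz_sub_trans (padic_addE _ _ _)).
apply: (dvdz_sub_trans (dvdz_subD (padic_oppE _ _) (dvdz_subr _ _))).
by rewrite addNr; apply/dvdz_subC/padic_constE.
Qed.

HB.instance Definition _ := GRing.isZmodule.Build Zp addA addC add0 addN.

Local Lemma mulA : associative padic_mul.
Proof.
move=> x y z; apply: padic_eqP => n.
apply: (dvdz_sub_trans (padic_mulE _ _ _)).
apply: (dvdz_sub_trans (dvdz_subM (dvdz_subr _ _) (padic_mulE _ _ _))).
rewrite mulrA; apply: dvdz_subC.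
apply: (dvdz_sub_trans (padic_mulE _ _ _)).
exact: (dvdz_subM (padic_mulE _ _ _) (dvdz_subr _ _)).
Qed.

Local Lemma mulC : commutative padic_mul.
Proof.
move=> x y; apply: padic_eqP => n.
apply: (dvdz_sub_trans (padic_mulE _ _ _)); apply: dvdz_subC.
by rewrite [x n * _]mulrC; apply: padic_mulE.
Qed.

Local Lemma mul1 : left_id (padic_const 1) padic_mul.
Proof.
move=> x; apply: padic_eqP => n; apply: (dvdz_sub_trans (padic_mulE _ _ _)).
rewrite -[X in (_ %| _ - X)%Z]mul1r.
exact: (dvdz_subM (padic_constE _ _) (dvdz_subr _ _)).
Qed.

Local Lemma mulD : left_distributive padic_mul +%R.
Proof.
move=> x y z; apply: padic_eqP => n; apply: (dvdz_sub_trans (padic_mulE _ _ _)).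
apply: (dvdz_sub_trans (dvdz_subM (padic_addE _ _ _) (dvdz_subr _ _))).
rewrite mulrDl; apply: dvdz_subC; apply: (dvdz_sub_trans (padic_addE _ _ _)).
by apply: dvdz_subD; apply: padic_mulE.
Qed.

Local Lemma one_neq0 : padic_const 1 != 0.
Proof.
apply/eqP => /(congr1 (fun x : Zp => (x 1%N))) /=.
by rewrite expn1 modz_small ?mod0z // ltz_nat prime_gt1.
Qed.

HB.instance Definition _ := GRing.Zmodule_isComNzRing.Build Zp
  mulA mulC mul1 mulD one_neq0.

Lemma residueD x y n : (q n %| (x + y) n - (x n + y n))%Z.
Proof. exact: padic_addE. Qed.
Lemma residueN x n : (q n %| (- x) n - - x n)%Z.
Proof. exact: padic_oppE. Qed.
Lemma residueM x y n : (q n %| (x * y) n - x n * y n)%Z.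
Proof. exact: padic_mulE. Qed.
Lemma residue0 n : (0 : Zp) n = 0.
Proof. exact: mod0z. Qed.
Lemma residue1 n : (q n %| (1 : Zp) n - 1)%Z.
Proof. exact: padic_constE. Qed.
Lemma residue_nat k n : (q n %| (k%:R : Zp) n - k%:Z)%Z.
Proof.
elim: k => [|k IHk]; first by rewrite residue0 subrr dvdz0.
rewrite -addn1 natrD PoszD; apply: (dvdz_sub_trans (residueD _ _ _)).
exact: dvdz_subD IHk (residue1 _).
Qed.

Lemma residue_eq0 x n m : (n <= m)%N -> (q n %| x m)%Z = (x n == 0).
Proof.
move=> nm; have d : (q n %| x m - x n)%Z by apply: residue_dvd.
apply/idP/eqP => [dm|x0]; last by rewrite x0 subr0 in d.
by rewrite -residue_mod; apply/dvdz_mod0P; rewrite -(rpredBl _ dm).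
Qed.

Lemma padic_neq0 x : x != 0 -> exists n, x n != 0.
Proof.
move=> xn0; apply: contrapT => /forallNP x0; case/eqP: xn0; apply: padic_eqP => n.
by have /negP/negPn/eqP -> := x0 n; rewrite residue0 subrr dvdz0.
Qed.

Local Lemma dvd_mul_pow n k (a b : int) :
  ~~ (q n %| a)%Z -> ~~ (q k %| b)%Z -> ~~ (q (n + k) %| a * b)%Z.
Proof.
rewrite !dvdzE /= abszM => na nb.
have a0 : (0 < `|a|)%N by rewrite lt0n; apply: contraNneq na => ->.
have b0 : (0 < `|b|)%N by rewrite lt0n; apply: contraNneq nb => ->.
move: na nb; rewrite !pfactor_dvdn ?muln_gt0 ?a0 // lognM // -!ltnNge.
by move=> *; rewrite -addSn leq_add // ltnW.
Qed.

Local Lemma mul_eq0 x y : x * y = 0 -> (x == 0) || (y == 0).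
Proof.
move=> xy0; apply/norP => -[/padic_neq0[n xn] /padic_neq0[k yk]].
have := residueM x y (n + k); rewrite xy0 residue0 sub0r rpredN.
apply/negP/dvd_mul_pow; rewrite residue_eq0 ?leq_addr ?leq_addl //.
Qed.

Definition padic_unit : {pred Zp} := fun x => `[< exists y, y * x = 1 >].
Definition padic_inv x : Zp :=
  if pselect (exists y, y * x = 1) is left e then projT1 (cid e) else x.

Local Lemma mulVx : {in padic_unit, left_inverse 1 padic_inv *%R}.
Proof.
by move=> x /asboolP xU; rewrite /padic_inv; case: pselect => // e; case: cid.
Qed.

Local Lemma unitP x y : y * x = 1 -> padic_unit x.
Proof. by move=> yx; apply/asboolP; exists y. Qed.

Local Lemma inv_out : {in [predC padic_unit], padic_inv =1 id}.
Proof.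
move=> x; rewrite inE /= /padic_unit unfold_in => /asboolPn nU.
by rewrite /padic_inv; case: pselect.
Qed.

HB.instance Definition _ :=
  GRing.ComNzRing_hasMulInverse.Build Zp mulVx unitP inv_out.
HB.instance Definition _ := GRing.ComUnitRing_isIntegral.Build Zp mul_eq0.

Lemma residue1_neq0 : (1 : Zp) 1%N != 0.
Proof.
apply/eqP => e; have := residue1 1; rewrite e sub0r rpredN dvdz1 /= expn1.
by apply/negP; rewrite neq_ltn prime_gt1 ?orbT.
Qed.

Lemma coprime_residue x n : x 1%N != 0 -> coprimez (q n) (x n).
Proof.
move=> x1; rewrite coprimezE; case: n => [|n]; first by rewrite /= coprime1n.
rewrite /= coprimeXl // prime_coprime //; apply: contraNN x1 => px.
by rewrite -(@residue_eq0 x 1 n.+1) // dvdzE /= expn1.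
Qed.

Lemma unit_residue x : (x \is a GRing.unit) = (x 1%N != 0).
Proof.
apply/idP/idP => [xU|x1].
  apply: contra_neq residue1_neq0 => x10; apply/eqP.
  rewrite -(@residue_eq0 _ 1 1) // -(mulVr xU).
  have := residueM x^-1 x 1; rewrite x10 mulr0 subr0; exact.
have /choice[u uP] n : exists c, (q n %| c * x n - 1)%Z.
  have [v [c e]] := Bezoutz (q n) (x n).
  exists c; have /eqP <- : gcdz (q n) (x n) == 1 := coprime_residue n x1.
  by rewrite -e opprD addrCA subrr addr0 rpredN dvdz_mull.
have cu : compatible u.
  move=> n; rewrite -(Gauss_dvdzl _ (coprime_residue n x1)) mulrBl.
  apply: (@dvdz_sub_trans _ 1); last exact/dvdz_subC/uP.
  apply: (@dvdz_sub_trans _ (u n.+1 * x n.+1)).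
    by apply: dvdz_subM (dvdz_subr _ _) _; apply/dvdz_subC/residue_dvd.
  exact: dvdz_trans (dvd_qq (leqnSn n)) (uP _).
apply/unitrPr; exists (plim cu); rewrite mulrC; apply: padic_eqP => n.
apply: (dvdz_sub_trans (residueM _ _ _)).
apply: (dvdz_sub_trans (dvdz_subM (plimP cu n) (dvdz_subr _ _))).
exact: dvdz_sub_trans (uP n) (dvdz_subC (residue1 n)).
Qed.

Lemma residueXp n m : (q m %| ((p%:R : Zp) ^+ n) m - q n)%Z.
Proof. by rewrite -natrX residue_nat. Qed.

Lemma padic_divX x n : x n = 0 -> exists y, x = p%:R ^+ n * y.
Proof.
move=> xn0; have qx k : (q n %| x (n + k)%N)%Z.
  by rewrite residue_eq0 ?leq_addr ?xn0.
have qM k : q (n + k) = q n * q k by rewrite expnD PoszM.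
pose u k := (x (n + k)%N %/ q n)%Z.
have uE k : x (n + k)%N = q n * u k by rewrite mulrC divzK.
have cu : compatible u.
  move=> k; rewrite -(dvdz_mul2l (q_neq0 n)) mulrBr -!uE -qM addnS.
  exact: residue_dvd.
exists (plim cu); apply: padic_eqP => k; apply: dvdz_subC.
apply: (dvdz_sub_trans (residueM _ _ _)).
apply: (dvdz_sub_trans (dvdz_subM (residueXp n k) (plimP cu k))).
by rewrite -uE residue_dvd ?leq_addl.
Qed.

Lemma residue_Xmul n y : ((p%:R : Zp) ^+ n * y) n = 0.
Proof.
apply/eqP; rewrite -(@residue_eq0 _ n n) //.
rewrite -[X in (_ %| X)%Z](subrK (q n * y n)); apply: rpredD.
  apply: (dvdz_sub_trans (residueM _ y n)).
  exact: dvdz_subM (residueXp n n) (dvdz_subr _ (y n)).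
exact: dvdz_mulr.
Qed.

Lemma p_neq0 : p%:R != 0 :> Zp.
Proof.
apply/eqP => e; have := residue_nat p 2; rewrite e residue0 sub0r rpredN.
by rewrite -[X in (_ %| X%:Z)%Z]expn1 dvdzE (dvdn_Pexp2l _ _ (prime_gt1 p_pr)).
Qed.

Lemma padic_decomp x : x != 0 ->
  exists n y, y \is a GRing.unit /\ x = p%:R ^+ n * y.
Proof.
move=> x0; have [n xn0 min_n] : exists2 n, x n != 0 & forall k, x k != 0 -> (n <= k)%N.
  by case: (ex_minnP (padic_neq0 x0)) => n xn min_n; exists n.
case: n => [|n] in xn0 min_n.
  by case/eqP: xn0; rewrite -residue_mod expn0 modz1.
have /padic_divX[y xE] : x n = 0.
  by apply/eqP; apply: contraT => /min_n; rewrite ltnn.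
exists n, y; split=> //; rewrite unit_residue.
apply: contra_neq xn0 => y1.
have [z yE] := padic_divX y1.
by rewrite xE yE mulrA -exprD addn1 residue_Xmul.
Qed.
End PadicInt.

Definition padic (p : nat) (p_pr : prime p) := {fraction (padic_int p_pr)}.
HB.instance Definition _ p p_pr := GRing.Field.on (@padic p p_pr).

Section PadicTopology.
Variables (p : nat) (p_pr : prime p).
Local Notation Zp := (padic_int p_pr).
Local Notation Qp := (padic p_pr).
Local Notation q n := (p ^ n)%N%:Z.

Definition padic_of_int (z : Zp) : Qp := FracField.tofrac z.
HB.instance Definition _ := GRing.isZmodMorphism.Build Zp Qp padic_of_int
  (@tofrac_is_zmod_morphism Zp).
HB.instance Definition _ := GRing.isMonoidMorphism.Build Zp Qp padic_of_int
  (@tofrac_is_monoid_morphism Zp).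

Definition padic_ball (x : Qp) (n : nat) : set Qp :=
  [set y | exists z : Zp, y - x = p%:R ^+ n * padic_of_int z].

HB.instance Definition _ :=
  hasNbhs.Build Qp (fun x => filter_from setT (padic_ball x)).

Lemma padic_of_int_inj : injective padic_of_int.
Proof. by move=> x y /eqP; rewrite tofrac_eq => /eqP. Qed.

Lemma padic_ball_refl x n : padic_ball x n x.
Proof. by exists 0; rewrite subrr rmorph0 mulr0. Qed.

Lemma padic_ball_trans y x z n :
  padic_ball x n y -> padic_ball y n z -> padic_ball x n z.
Proof.
by move=> [a ya] [b zb]; exists (b + a); rewrite rmorphD mulrDr -ya -zb addrA subrK.
Qed.

Lemma padic_ballW x n m : (n <= m)%N -> padic_ball x m `<=` padic_ball x n.
Proof.
move=> nm y [a ya]; exists (p%:R ^+ (m - n) * a).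
by rewrite rmorphM rmorphXn rmorph_nat mulrA -exprD subnKC.
Qed.

Local Lemma padic_nbhs_filter (x : Qp) : ProperFilter (nbhs x).
Proof.
apply: filter_from_proper; last by move=> n _; exists x; apply: padic_ball_refl.
apply: filter_from_filter; first by exists 0%N.
move=> n m _ _; exists (maxn n m) => // y xy.
by split; move: xy; apply: padic_ballW; rewrite ?leq_maxl ?leq_maxr.
Qed.

Local Lemma padic_nbhs_singleton (x : Qp) (A : set Qp) : nbhs x A -> A x.
Proof. by move=> [n _]; apply; apply: padic_ball_refl. Qed.

Local Lemma padic_nbhs_nbhs (x : Qp) (A : set Qp) :
  nbhs x A -> nbhs x (nbhs^~ A).
Proof.
move=> [n _ xA]; exists n => // y xy; exists n => // z yz.
by apply: xA; apply: padic_ball_trans yz.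
Qed.

HB.instance Definition _ := Nbhs_isNbhsTopological.Build Qp
  padic_nbhs_filter padic_nbhs_singleton padic_nbhs_nbhs.

Lemma pX_neq0 n : (p%:R : Qp) ^+ n != 0.
Proof.
by rewrite expf_neq0 // -(rmorph_nat padic_of_int) tofrac_eq0 p_neq0.
Qed.

Lemma padic_fracE (x : Qp) : exists a b : Zp,
  b != 0 /\ x * padic_of_int b = padic_of_int a.
Proof.
elim/quotW: x => r; exists (frac r).1, (frac r).2.
split; first exact: denom_ratioP.
rewrite /padic_of_int; unlock FracField.tofrac.
rewrite -[LHS]FracField.pi_mul; apply/eqmodP.
rewrite /= FracField.equivfE /FracField.mulf.
by rewrite !(numden_Ratio, mulf_neq0, oner_neq0, denom_ratioP) // !mulr1 mulrC.
Qed.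

Lemma padic_denom (x : Qp) :
  exists n (z : Zp), p%:R ^+ n * x = padic_of_int z.
Proof.
have [a [b [b0 xb]]] := padic_fracE x.
have [n [y [yU bE]]] := padic_decomp b0.
exists n, (a / y); rewrite rmorphM /= -xb bE !rmorphM rmorphXn rmorph_nat.
by rewrite mulrC -!mulrA -rmorphM mulrV // rmorph1 mulr1.
Qed.


Lemma padic_ultra_cvg T (F : set_system T) (f : T -> Qp) : UltraFilter F ->
  F (f @^-1` range padic_of_int) -> exists z : Zp, f @ F --> padic_of_int z.
Proof.
move=> FU Ff.
pose U n (c : int) : set T :=
  [set t | exists2 x : Zp, f t = padic_of_int x & (q n %| x n - c)%Z].
have /choice[u uP] n : exists c, F (U n c).
  apply: contrapT => /forallNP nU.
  have nUF (i : 'I_(p ^ n)) : F (~` U n (i : nat)).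
    by have [/nU|] := in_ultra_setVsetC (U n (i : nat)) FU.
  have FnU : F [set t | forall i : 'I_(p ^ n), (~` U n (i : nat)) t].
    exact: filter_forall.
  have [t [[x _ xt] nt]] := filter_ex (filterI Ff FnU).
  have x0 : 0 <= x n by rewrite -residue_mod modz_ge0 ?q_neq0.
  have xlt : (`|x n|%N < p ^ n)%N.
    by rewrite -ltz_nat gez0_abs // -residue_mod ltz_pmod // ltz_nat expn_gt0 prime_gt0.
  apply: (nt (Ordinal xlt)); exists x; first exact/esym.
  by rewrite /= gez0_abs // subrr dvdz0.
have cu : compatible p u.
  move=> n; have [t [[x xt xd] [y yt yd]]] := filter_ex (filterI (uP n) (uP n.+1)).
  have exy : x = y by apply: padic_of_int_inj; rewrite -xt -yt.
  rewrite -exy in yd.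
  apply: (@dvdz_sub_trans _ (x n.+1)).
    exact: dvdz_trans (dvd_qq p (leqnSn n)) (dvdz_subC yd).
  exact: dvdz_sub_trans (residue_dvd _ (leqnSn n)) xd.
exists (plim p_pr cu); move=> A [n _ nA]; change (F (f @^-1` A)).
apply: filterS (uP n) => t [x xt xd]; apply: nA.
have /padic_divX[y xyE] : (x - plim p_pr cu) n = 0.
  apply/eqP; rewrite -(@residue_eq0 _ _ _ n n) //.
  rewrite -[X in (_ %| X)%Z](subrK (x n + (- plim p_pr cu) n)).
  apply: rpredD; first exact: residueD.
  rewrite -[X in (_ %| X)%Z](subrK (x n - (plim p_pr cu) n)).
  apply: rpredD; first exact: dvdz_subD (dvdz_subr _ _) (residueN _ _).
  exact: dvdz_sub_trans xd (dvdz_subC (plimP p_pr cu n)).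
by exists y; rewrite xt -rmorphB xyE rmorphM rmorphXn rmorph_nat.
Qed.

Lemma padic_unit_closed (z y : Zp) : y \is a GRing.unit ->
  padic_ball (padic_of_int z) 1 (padic_of_int y) -> z \is a GRing.unit.
Proof.
rewrite !unit_residue => y1 [a]; rewrite -rmorphB.
rewrite -(rmorph_nat padic_of_int) -rmorphXn -rmorphM => /padic_of_int_inj e.
apply: contraNN y1 => /eqP z1.
rewrite -(subrK z y) e -(@residue_eq0 _ _ _ 1 1) //.
rewrite -[X in (_ %| X)%Z](subrK ((p%:R ^+ 1 * a) 1%N + z 1%N)).
by apply: rpredD; rewrite ?residueD // z1 addr0 residue_Xmul dvdz0.
Qed.

End PadicTopology.

Record borel (F : fieldType) := Borel {
  borel_mx :> 'M[F]_2;
  borelP : (borel_mx 1 0 == 0) && (borel_mx \in unitmx) }.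

Section Borel.
Variable F : fieldType.
Local Notation B := (borel F).

HB.instance Definition _ := [isSub for @borel_mx F].
HB.instance Definition _ := [Choice of B by <:].

Lemma borel10 (g : B) : g 1 0 = 0.
Proof. by have /andP[/eqP] := borelP g. Qed.

Lemma borel_unit (g : B) : (g : 'M_2) \in unitmx.
Proof. by have /andP[] := borelP g. Qed.

Lemma mx2_mulE (M N : 'M[F]_2) i j : (M *m N) i j = M i 0 * N 0 j + M i 1 * N 1 j.
Proof.
rewrite mxE big_ord_recl big_ord1; congr (_ + M i _ * N _ j); exact: val_inj.
Qed.

Lemma borel_one_subproof :
  ((1%:M : 'M[F]_2) 1 0 == 0) && ((1%:M : 'M[F]_2) \in unitmx).
Proof. by rewrite unitmx1 mxE eqxx. Qed.

Lemma borel_mul_subproof (g h : B) :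
  ((g *m h : 'M[F]_2) 1 0 == 0) && ((g *m h : 'M[F]_2) \in unitmx).
Proof. by rewrite unitmx_mul !borel_unit mx2_mulE !borel10 mul0r mulr0 addr0 eqxx. Qed.

Lemma ord2P (k : 'I_2) : k = 0 \/ k = 1.
Proof. by case: k => -[|[|//]] k2; [left|right]; apply: val_inj. Qed.

Lemma det_upper (M : 'M[F]_2) : M 1 0 = 0 -> \det M = M 0 0 * M 1 1.
Proof.
move=> M10; rewrite -det_tr det_trig.
  by rewrite big_ord_recl big_ord1 !mxE; congr (_ * M _ _); exact: val_inj.
by apply/is_trig_mxP => i j; case: (ord2P i) (ord2P j) => -> [] -> //; rewrite mxE.
Qed.

Lemma borel_diag (g : B) : (g 0 0 != 0) && (g 1 1 != 0).
Proof.
have := borel_unit g; rewrite unitmxE det_upper ?borel10 //.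
by rewrite unitfE mulf_eq0 negb_or.
Qed.

Lemma borel_inv_subproof (g : B) :
  ((invmx g : 'M[F]_2) 1 0 == 0) && ((invmx g : 'M[F]_2) \in unitmx).
Proof.
rewrite unitmx_inv borel_unit andbT.
have /andP[g00 _] := borel_diag g.
have : (invmx g *m g) 1 0 = 0 by rewrite mulVmx ?borel_unit // mxE.
by rewrite mx2_mulE borel10 mulr0 addr0 => /eqP; rewrite mulf_eq0 (negPf g00) orbF.
Qed.

Definition borel_one := Borel borel_one_subproof.
Definition borel_mul (g h : B) := Borel (borel_mul_subproof g h).
Definition borel_inv (g : B) := Borel (borel_inv_subproof g).

Local Lemma borel_mulA : associative borel_mul.
Proof. by move=> g h k; apply: val_inj; apply: mulmxA. Qed.
Local Lemma borel_mul1 : left_id borel_one borel_mul.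
Proof. by move=> g; apply: val_inj; apply: mul1mx. Qed.
Local Lemma borel_mulr1 : right_id borel_one borel_mul.
Proof. by move=> g; apply: val_inj; apply: mulmx1. Qed.
Local Lemma borel_mulV : left_inverse borel_one borel_inv borel_mul.
Proof. by move=> g; apply: val_inj; apply/mulVmx/borel_unit. Qed.
Local Lemma borel_mulrV : right_inverse borel_one borel_inv borel_mul.
Proof. by move=> g; apply: val_inj; apply/mulmxV/borel_unit. Qed.

HB.instance Definition _ := isGroup.Build B
  borel_mulA borel_mul1 borel_mulr1 borel_mulV borel_mulrV.

Definition trig_mx (a b d : F) : 'M[F]_2 :=
  \matrix_(i, j) if i == 0 then (if j == 0 then a else b)
                 else (if j == 0 then 0 else d).

Lemma trig_mx_subproof a b d : a != 0 -> d != 0 ->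
  (trig_mx a b d 1 0 == 0) && (trig_mx a b d \in unitmx).
Proof.
by move=> a0 d0; rewrite unitmxE det_upper !mxE //= unitfE mulf_neq0 ?eqxx.
Qed.

Definition borel_trig a b d (a0 : a != 0) (d0 : d != 0) : B :=
  Borel (trig_mx_subproof b a0 d0).

Lemma borelE (g h : B) :
  g 0 0 = h 0 0 -> g 0 1 = h 0 1 -> g 1 1 = h 1 1 -> g = h.
Proof.
move=> e00 e01 e11; apply: val_inj; apply/matrixP => i j /=.
by case: (ord2P i) (ord2P j) => -> [] ->; rewrite ?borel10.
Qed.
End Borel.

HB.instance Definition _ p (p_pr : prime p) :=
  Topological.copy (borel (padic p_pr))
    (initial_topology (@borel_mx (padic p_pr))).

Section BorelTopology.
Variables (p : nat) (p_pr : prime p).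
Local Notation Zp := (padic_int p_pr).
Local Notation Qp := (padic p_pr).
Local Notation B := (borel Qp).

Definition padic_integral : set Qp := range (@padic_of_int p p_pr).
Definition padic_integral_unit : set Qp :=
  [set padic_of_int z | z in [set z : Zp | z \is a GRing.unit]].

Definition borel_K : set B :=
  [set k | [/\ padic_integral_unit (k 0 0), padic_integral_unit (k 1 1) & padic_integral (k 0 1)]].
Definition borel_Z : set B := [set z | forall g : B, commute z g].
Definition borel_KZ : set B := [set (k * z)%g | k in borel_K & z in borel_Z].

Lemma borel_cvg (F : set_system B) (g : B) : Filter F ->
  (forall i j, (fun h : B => h i j) @ F --> g i j) -> F --> g.
Proof.
move=> FF cF A [_ [[U Uo <-] gU UA]].
have [P gP PU] : nbhs (g : 'M_2) U by apply: open_nbhs_nbhs.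
pose f (ij : 'I_2 * 'I_2) := [set h : B | P ij.1 ij.2 (h ij.1 ij.2)].
have fF ij : F (f ij) by apply: (cF ij.1 ij.2); apply: gP.
have FP : F [set h | forall ij, f ij h] by exact: filter_forall.
by apply: filterS FP => h hP; apply/UA/PU => i j; apply: (hP (i, j)).
Qed.

Lemma borel_entry_continuous (i j : 'I_2) (g : B) :
  (fun h : B => h i j) @ g --> g i j.
Proof.
move=> A gA.
have cM : (@borel_mx Qp : B -> 'M[Qp]_2) @ g --> (g : 'M[Qp]_2).
  exact: (@initial_continuous _ _ (@borel_mx Qp)).
apply: (cM [set M : 'M[Qp]_2 | A (M i j)]).
exists (fun i' j' => if (i' == i) && (j' == j) then A else setT).
  by move=> i' j'; case: ifP => [/andP[/eqP -> /eqP ->]|_] //; apply: filterT.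
by move=> M /(_ i j); rewrite !eqxx.
Qed.

Lemma compact_K : compact borel_K.
Proof.
rewrite compact_ultra => F FU FK.
have cU (f : B -> Qp) : F (f @^-1` padic_integral_unit) ->
    exists2 z : Zp, z \is a GRing.unit & f @ F --> padic_of_int z.
  move=> Ff; have [|z fz] := @padic_ultra_cvg _ _ _ F f FU.
    by apply: filterS Ff => g [z _ zE]; exists z.
  exists z => //.
  have Fz : F (f @^-1` padic_ball (padic_of_int z) 1) by apply: fz; exists 1%N.
  have [g [[y yU yE] gz]] := filter_ex (filterI Ff Fz).
  by apply: padic_unit_closed yU _; rewrite yE.
have [a aU aF] : exists2 z : Zp, z \is a GRing.unit &
    (fun g : B => g 0 0) @ F --> padic_of_int z.
  by apply: cU; apply: filterS FK => g [].
have [d dU dF] : exists2 z : Zp, z \is a GRing.unit &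
    (fun g : B => g 1 1) @ F --> padic_of_int z.
  by apply: cU; apply: filterS FK => g [].
have [b bF] : exists z : Zp, (fun g : B => g 0 1) @ F --> padic_of_int z.
  by apply: padic_ultra_cvg; apply: filterS FK => g [].
have nz (z : Zp) : z \is a GRing.unit -> padic_of_int z != 0.
  by move=> zU; rewrite tofrac_eq0; apply: contraTneq zU => ->; rewrite unitr0.
exists (borel_trig (padic_of_int b) (nz a aU) (nz d dU)); split.
  by split; rewrite mxE /=; [exists a|exists d|exists b].
apply: borel_cvg => i j.
case: (ord2P i) (ord2P j) => -> [] ->; rewrite mxE //=.
have -> : (fun h : B => h 1 0) = cst 0 by apply/funext => h; apply: borel10.
exact: cvg_cst.
Qed.

Lemma padic_add_cvg T (F : set_system T) (f g : T -> Qp) (x y : Qp) : Filter F ->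
  f @ F --> x -> g @ F --> y -> (fun t => f t + g t) @ F --> x + y.
Proof.
move=> FF fx gy A [n _ nA]; change (F ((fun t => f t + g t) @^-1` A)).
have Fx : F (f @^-1` padic_ball x n) by apply: fx; exists n.
have Fy : F (g @^-1` padic_ball y n) by apply: gy; exists n.
apply: filterS (filterI Fx Fy) => t [[a ta] [b tb]]; apply: nA.
by exists (a + b); rewrite rmorphD mulrDr -ta -tb opprD addrACA.
Qed.

Lemma padic_mulr_cvg T (F : set_system T) (f : T -> Qp) (x c : Qp) : Filter F ->
  f @ F --> x -> (fun t => f t * c) @ F --> x * c.
Proof.
move=> FF fx A [n _ nA]; change (F ((fun t => f t * c) @^-1` A)).
have [k [z cz]] := padic_denom c.
have Fx : F (f @^-1` padic_ball x (n + k)) by apply: fx; exists (n + k)%N.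
apply: filterS Fx => t [a ta]; apply: nA.
exists (a * z); rewrite rmorphM /= -cz -mulrBl ta exprD; ring.
Qed.

Lemma compact_borel_mulr (C : set B) (g : B) :
  compact C -> compact [set (c * g)%g | c in C].
Proof.
move=> cC; apply: (@continuous_compact _ _ (fun h : B => (h * g)%g)) => //.
apply: continuous_subspaceT => h.
have hF : Filter ((fun h : B => (h * g)%g) @ h) := fmap_filter _ (nbhs_filter h).
apply: borel_cvg => i j; rewrite [X in _ --> X]mx2_mulE.
change ((fun k : B => (k *m g : 'M[Qp]_2) i j) @ h -->
  h i 0 * g 0 j + h i 1 * g 1 j).
under [X in X @ _]eq_fun do rewrite mx2_mulE.
have nF : Filter (nbhs h) := nbhs_filter h.
by apply: (@padic_add_cvg _ (nbhs h) (fun k : B => k i 0 * g 0 j));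
  apply: (@padic_mulr_cvg _ (nbhs h) (fun k : B => k _ _));
  apply: borel_entry_continuous.
Qed.

End BorelTopology.

Record rep (E : fieldType) (G : groupType) := Rep {
  rep_space :> lmodType E;
  rep_act : G -> rep_space -> rep_space;
  rep_actP : forall g a u v,
    rep_act g (a *: u + v) = a *: rep_act g u + rep_act g v;
  rep_act1 : forall v, rep_act 1%g v = v;
  rep_actM : forall g h v, rep_act (g * h)%g v = rep_act g (rep_act h v) }.

Definition irreducible (E : fieldType) (G : groupType) (V : rep E G) : Prop :=
  (exists v : V, v != 0) /\
  forall W : {pred V}, submod_closed W ->
    (forall g v, v \in W -> rep_act g v \in W) ->
    (forall v, v \in W -> v = 0) \/ (forall v, v \in W).

Section QuotientRep.
Variables (E : fieldType) (G : groupType) (V : rep E G) (w : V).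

Lemma rep_act0 g : rep_act g (0 : V) = 0.
Proof. by have := rep_actP g (-1) (0 : V) 0; rewrite scaler0 add0r scaleN1r addNr. Qed.

Lemma rep_actD g (u v : V) : rep_act g (u + v) = rep_act g u + rep_act g v.
Proof. by have := rep_actP g 1 u v; rewrite !scale1r. Qed.

Lemma rep_actZ g a (u : V) : rep_act g (a *: u) = a *: rep_act g u.
Proof. by have := rep_actP g a u 0; rewrite !addr0 rep_act0 addr0. Qed.

Lemma rep_actB g (u v : V) : rep_act g (u - v) = rep_act g u - rep_act g v.
Proof. by rewrite -scaleN1r rep_actD rep_actZ scaleN1r. Qed.

Definition translates_span : {pred V} := fun v =>
  `[< exists s : seq (E * G), v = \sum_(c <- s) c.1 *: rep_act c.2 w >].

Lemma translates_span_submod : submod_closed translates_span.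
Proof.
split; first by apply/asboolP; exists [::]; rewrite big_nil.
move=> a u v /asboolP[s ->] /asboolP[t ->]; apply/asboolP.
exists ([seq (a * c.1, c.2) | c <- s] ++ t).
rewrite big_cat big_map scaler_sumr; congr (_ + _).
by apply: eq_bigr => c _; rewrite scalerA.
Qed.

HB.instance Definition _ :=
  GRing.isSubmodClosed.Build E V translates_span translates_span_submod.

Lemma translates_span_act g v :
  v \in translates_span -> rep_act g v \in translates_span.
Proof.
move=> /asboolP[s ->]; apply/asboolP.
exists [seq (c.1, (g * c.2)%g) | c <- s]; rewrite big_map.
rewrite (big_morph _ (rep_actD g) (rep_act0 g)).
by apply: eq_bigr => c _; rewrite rep_actZ rep_actM.
Qed.

Definition quot_space := @Quotient.quot V translates_span.
HB.instance Definition _ := GRing.Zmodule.on quot_space.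
Local Notation Q := quot_space.
Local Open Scope quotient_scope.

Definition quot_pi (v : V) : Q := \pi_Q v.

Lemma quot_piP u v : quot_pi u = quot_pi v <-> u - v \in translates_span.
Proof. by rewrite Quotient.idealrBE; split=> [/eqP|/eqP]. Qed.

Lemma quot_reprP (x : Q) : quot_pi (repr x) = x.
Proof. exact: reprK. Qed.

Lemma quot_piD u v : quot_pi (u + v) = quot_pi u + quot_pi v.
Proof. exact: raddfD. Qed.

Definition quot_scale (a : E) (x : Q) : Q := quot_pi (a *: repr x).

Lemma quot_scaleE a v : quot_scale a (quot_pi v) = quot_pi (a *: v).
Proof. by apply/quot_piP; rewrite -scalerBr rpredZ //; apply/quot_piP/quot_reprP. Qed.

Local Lemma quot_scaleA a b x :
  quot_scale a (quot_scale b x) = quot_scale (a * b) x.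
Proof. by rewrite -(quot_reprP x) !quot_scaleE scalerA. Qed.
Local Lemma quot_scale1 : left_id 1 quot_scale.
Proof. by move=> x; rewrite -(quot_reprP x) quot_scaleE scale1r. Qed.
Local Lemma quot_scaleDr : right_distributive quot_scale +%R.
Proof.
move=> a x y; rewrite -(quot_reprP x) -(quot_reprP y).
by rewrite -quot_piD !quot_scaleE -quot_piD scalerDr.
Qed.
Local Lemma quot_scaleDl x : {morph quot_scale^~ x : a b / a + b}.
Proof. by move=> a b; rewrite -(quot_reprP x) !quot_scaleE -quot_piD scalerDl. Qed.

HB.instance Definition _ := GRing.Zmodule_isLmodule.Build E Q
  quot_scaleA quot_scale1 quot_scaleDr quot_scaleDl.

Definition quot_act (g : G) (x : Q) : Q := quot_pi (rep_act g (repr x)).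

Lemma quot_actE g v : quot_act g (quot_pi v) = quot_pi (rep_act g v).
Proof.
apply/quot_piP; rewrite -rep_actB; apply: translates_span_act.
exact/quot_piP/quot_reprP.
Qed.

Local Lemma quot_actP g a (u v : Q) :
  quot_act g (a *: u + v) = a *: quot_act g u + quot_act g v.
Proof.
rewrite -(quot_reprP u) -(quot_reprP v).
change (quot_act g (quot_scale a (quot_pi (repr u)) + quot_pi (repr v)) =
  quot_scale a (quot_act g (quot_pi (repr u))) + quot_act g (quot_pi (repr v))).
by rewrite quot_scaleE -quot_piD !quot_actE quot_scaleE -quot_piD rep_actP.
Qed.
Local Lemma quot_act1 v : quot_act 1%g v = v.
Proof. by rewrite -(quot_reprP v) quot_actE rep_act1. Qed.
Local Lemma quot_actM g h v : quot_act (g * h)%g v = quot_act g (quot_act h v).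
Proof. by rewrite -(quot_reprP v) !quot_actE rep_actM. Qed.

Definition quot_rep : rep E G := Rep quot_actP quot_act1 quot_actM.
End QuotientRep.

Section KZ.
Variables (p : nat) (p_pr : prime p).
Local Notation Zp := (padic_int p_pr).
Local Notation B := (borel (padic p_pr)).
Local Notation K := (@borel_K p p_pr).
Local Notation Z := (@borel_Z p p_pr).
Local Notation KZ := (@borel_KZ p p_pr).

Lemma borel_mulE00 (g h : B) : (g * h)%g 0 0 = g 0 0 * h 0 0.
Proof. by rewrite [LHS]mx2_mulE borel10 mulr0 addr0. Qed.
Lemma borel_mulE11 (g h : B) : (g * h)%g 1 1 = g 1 1 * h 1 1.
Proof. by rewrite [LHS]mx2_mulE borel10 mul0r add0r. Qed.
Lemma borel_mulE01 (g h : B) : (g * h)%g 0 1 = g 0 0 * h 0 1 + g 0 1 * h 1 1.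
Proof. by rewrite [LHS]mx2_mulE. Qed.

Lemma padic_intM (x y : Zp) :
  padic_of_int (x * y) = padic_of_int x * padic_of_int y.
Proof. exact: rmorphM. Qed.
Lemma padic_intD (x y : Zp) :
  padic_of_int (x + y) = padic_of_int x + padic_of_int y.
Proof. exact: rmorphD. Qed.
Lemma padic_int_mulV (x : Zp) : x \is a GRing.unit ->
  padic_of_int x * padic_of_int x^-1 = 1.
Proof. by move=> xU; rewrite -padic_intM mulrV // [LHS]rmorph1. Qed.

Lemma K_mul (k l : B) : K k -> K l -> K (k * l)%g.
Proof.
move=> [[a aU ka] [d dU kd] [b _ kb]] [[a' aU' la] [d' dU' ld] [b' _ lb]].
split.
- exists (a * a'); first by apply: (introT idP); rewrite unitrM aU aU'.
  by rewrite borel_mulE00 padic_intM ka la.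
- exists (d * d'); first by apply: (introT idP); rewrite unitrM dU dU'.
  by rewrite borel_mulE11 padic_intM kd ld.
- exists (a * b' + b * d') => //.
  by rewrite borel_mulE01 padic_intD !padic_intM ka lb kb ld.
Qed.

Lemma K_inv (k : B) : K k -> K (k^-1)%g.
Proof.
move=> [[a aU ka] [d dU kd] [b _ kb]].
have /andP[a0 d0] := borel_diag k.
have e00 : (k^-1)%g 0 0 = padic_of_int a^-1.
  apply: (mulfI a0); rewrite -borel_mulE00 mulgV -ka padic_int_mulV //.
  by rewrite mxE.
have e11 : (k^-1)%g 1 1 = padic_of_int d^-1.
  apply: (mulfI d0); rewrite -borel_mulE11 mulgV -kd padic_int_mulV //.
  by rewrite mxE.
have aV : a^-1 \is a GRing.unit by rewrite unitrV.
have dV : d^-1 \is a GRing.unit by rewrite unitrV.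
split; [by exists a^-1|by exists d^-1|].
exists (a^-1 * - (b * d^-1)) => //; apply: (mulfI a0).
have e01 : k 0 0 * (k^-1)%g 0 1 + k 0 1 * (k^-1)%g 1 1 = 0.
  by rewrite -borel_mulE01 mulgV mxE.
apply: (addIr (k 0 1 * (k^-1)%g 1 1)); rewrite e01 e11 padic_intM -ka -kb.
rewrite mulrA padic_int_mulV // mul1r -padic_intM -padic_intD addNr.
exact: rmorph0.
Qed.

Lemma KZ_mul (k l : B) : KZ k -> KZ l -> KZ (k * l)%g.
Proof.
move=> [k0 kK [z zZ <-]] [l0 lK [y yZ <-]].
exists (k0 * l0)%g; first exact: K_mul.
exists (z * y)%g.
  by move=> g; rewrite /commute -mulgA (yZ g) mulgA (zZ g) mulgA.
by rewrite -!mulgA; congr (_ * _)%g; rewrite !mulgA (zZ l0).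
Qed.

Lemma KZ_inv (k : B) : KZ k -> KZ (k^-1)%g.
Proof.
move=> [k0 kK [z zZ <-]]; exists (k0^-1)%g; first exact: K_inv.
have zZ' : Z (z^-1)%g.
  move=> g; rewrite /commute; apply: (mulgI z); rewrite mulgA mulgV mul1g.
  by rewrite mulgA (zZ g) -mulgA mulgV mulg1.
by exists (z^-1)%g => //; rewrite invgM (zZ' (k0^-1)%g).
Qed.
End KZ.

(* A character of Q_p^* is encoded as a function on all of Q_p; its value at 0 is
   arbitrary and never used. *)
Record smooth_char (p : nat) (p_pr : prime p) (E : fieldType) := SmoothChar {
  schar :> padic p_pr -> E;
  schar_neq0 : forall x, x != 0 -> schar x != 0;
  scharM : forall x y, x != 0 -> y != 0 -> schar (x * y) = schar x * schar y;
  schar_smooth : open [set x | x != 0 /\ schar x = 1] }.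

Section Induction.
Variables (p : nat) (p_pr : prime p) (E : fieldType).
Variables (sigma1 sigma2 : smooth_char p_pr E).
Local Notation Qp := (padic p_pr).
Local Notation B := (borel Qp).
Local Notation K := (@borel_K p p_pr).
Local Notation Z := (@borel_Z p p_pr).
Local Notation KZ := (@borel_KZ p p_pr).

Definition sigma (g : B) : E := sigma1 (g 0 0) * sigma2 (g 1 1).

(* The second clause is compactness of the support modulo Z: the support is
   contained in Z C for some compact C. *)
Definition in_ind : {pred B -> E^o} := fun f =>
  `[< (forall k g, KZ k -> f (k * g)%g = sigma k * f g) /\
      exists2 C : set B, compact C &
        [set g | f g != 0] `<=` [set (z * c)%g | z in Z & c in C] >].

Lemma sigmaM g h : sigma (g * h)%g = sigma g * sigma h.
Proof.
have /andP[g0 g1] := borel_diag g; have /andP[h0 h1] := borel_diag h.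
have -> : sigma (g * h)%g = sigma1 (g 0 0 * h 0 0) * sigma2 (g 1 1 * h 1 1).
  by congr (sigma1 _ * sigma2 _); rewrite mx2_mulE ?borel10 ?mulr0 ?mul0r ?addr0 ?add0r.
by rewrite (scharM sigma1 g0 h0) (scharM sigma2 g1 h1) mulrACA.
Qed.

Lemma in_ind_submod : submod_closed in_ind.
Proof.
split.
  apply/asboolP; split=> [k g _|]; first by rewrite /= mulr0.
  by exists set0; [exact: compact0|move=> g /=; rewrite eqxx].
move=> a u v /asboolP[uK [Cu cu uC]] /asboolP[vK [Cv cv vC]]; apply/asboolP.
have fE g : (a *: u + v) g = a * u g + v g by [].
split=> [k g kK|]; first by rewrite !fE uK // vK // mulrDr mulrCA.
exists (Cu `|` Cv); first exact: compactU.
move=> g /=; have [u0|/eqP ug] := eqVneq (u g) 0; last first.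
  by move=> _; have [|z zZ [c cC <-]] := uC g; [exact/eqP|exists z => //; exists c => //; left].
have [v0|vg] := eqVneq (v g) 0.
  by rewrite fE u0 v0 mulr0 addr0 eqxx.
by move=> _; have [z zZ [c cC <-]] := vC g vg; exists z => //; exists c => //; right.
Qed.

HB.instance Definition _ :=
  GRing.isSubmodClosed.Build E (B -> E^o) in_ind in_ind_submod.

Record ind := Ind { ind_fun :> B -> E^o; indP : ind_fun \in in_ind }.
HB.instance Definition _ := [isSub for ind_fun].
HB.instance Definition _ := [Choice of ind by <:].
HB.instance Definition _ := [SubChoice_isSubLmodule of ind by <:].

Lemma ind_act_subproof (g : B) (f : ind) : (fun h => f (h * g)%g) \in in_ind.
Proof.
have /asboolP[fK [C cC fC]] := indP f; apply/asboolP; split.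
  by move=> k h kK; rewrite -mulgA; apply: fK.
exists [set (c * g^-1)%g | c in C]; first exact: compact_borel_mulr.
move=> h /fC[z zZ [c cC' e]]; exists z => //; exists (c * g^-1)%g; first by exists c.
by rewrite mulgA e mulgK.
Qed.

Definition ind_act (g : B) (f : ind) : ind := Ind (ind_act_subproof g f).

Local Lemma ind_actP g a (u v : ind) :
  ind_act g (a *: u + v) = a *: ind_act g u + ind_act g v.
Proof. exact: val_inj. Qed.
Local Lemma ind_act1 v : ind_act 1%g v = v.
Proof. by apply: val_inj; apply/funext => h /=; rewrite mulg1. Qed.
Local Lemma ind_actM g h v : ind_act (g * h)%g v = ind_act g (ind_act h v).
Proof. by apply: val_inj; apply/funext => k /=; rewrite mulgA. Qed.

Definition ind_rep : rep E B := Rep ind_actP ind_act1 ind_actM.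

Definition bracket_fun (g : B) : B -> E^o := fun h =>
  if `[< [set (k * g^-1)%g | k in KZ] h >] then sigma (h * g)%g else 0.

Lemma bracket_subproof g : bracket_fun g \in in_ind.
Proof.
apply/asboolP; split=> [k h kKZ|].
  rewrite /bracket_fun; have [hg|hg] := asboolP (_ h).
    case: asboolP => [_|[]]; first by rewrite -mulgA; apply: sigmaM.
    case: hg => l lKZ <-; exists (k * l)%g; last by rewrite mulgA.
    exact: KZ_mul.
  case: asboolP => [[l lKZ e]|_]; last by rewrite mulr0.
  case: hg; exists (k^-1 * l)%g; first exact/KZ_mul/lKZ/KZ_inv.
  by rewrite -mulgA e mulKg.
exists [set (k * g^-1)%g | k in borel_K (p_pr := p_pr)].
  exact/compact_borel_mulr/compact_K.
move=> h /=; rewrite /bracket_fun; case: asboolP => [[_ [k kK [z zZ <-]] <-] _|_].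
  exists z => //; exists (k * g^-1)%g; first by exists k.
  by rewrite mulgA (zZ k).
by rewrite eqxx.
Qed.

Definition bracket (g : B) : ind := Ind (bracket_subproof g).

Definition unip (x : Qp) : B := borel_trig x (oner_neq0 _) (oner_neq0 _).
Definition diag_p n : B := borel_trig 0 (oner_neq0 _) (pX_neq0 p_pr n).

Definition w_elt (l n : nat) : ind :=
  \sum_(0 <= j < p ^ n) 'C(j, l)%:R *: bracket (unip (- (j%:R * p%:R ^- n))).

Definition S_generator (n h : nat) : ind :=
  (- (sigma1 p%:R)^-1) ^+ n *: bracket (diag_p n) + w_elt (h * p.-1)%N n.

Definition Pi (n h : nat) : rep E B := @quot_rep E B ind_rep (S_generator n h).
End Induction.

Definition primitive (p n h : nat) : Prop :=
  [/\ (1 <= h)%N, (h <= p ^ n - 2)%N &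
    ~ exists d, [/\ (d < n)%N, (d %| n)%N & ((p ^ n - 1) %/ (p ^ d - 1) %| h)%N]].

(* Main.v *)
From HB Require Import structures.
Require Import Defs.
From mathcomp Require Import all_boot all_order all_algebra all_field.
From mathcomp Require Import all_classical topology ring.
From mathcomp Require Import zify.

(** Write q = p^n, m = q - 1 - h(p-1), e = [1] and e_d = diag(1,p^d) e. The operator
    X_N = u(p^-N) - 1 is an element "X^(1/p^N)": X_N = X_(N+1)^p in characteristic p, and e_d
    is annihilated by X_N^(p^(N-d)). Since sum_j C(j,l) Y^(q-j) = Y (Y-1)^(q-1-l), the defining
    relation says that e_(d+n) is a unit times X_(d+n)^m e_d. Iterating it, X_N^t e_d vanishes
    as soon as its depth p^(N-d) m - t (q-1) is negative, and generates some e_d' when the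
    depth is positive; the depth is never 0.

    After a shift by diag(1,p^D), every vector is a combination of polynomials in X_N applied
    to e_0, ..., e_(n-1). Given a nonzero vector of a subrepresentation, a power of X at a finer
    level kills everything but the monomials of maximal depth. If two components survive,
    diag(g,1), with g prime to p, multiplies them by different powers of g because h is
    primitive, and a linear combination has fewer components. One component left gives e_d',
    hence everything.

    For nonvanishing, suppose e_D is a combination of relations; comparing components in the
    lowest degree of the grading by d, each coefficient that kills the bottom part of a relation
    also kills its top part, so the terms below degree D vanish; in degree D the relation
    contributes a multiple of X^m with m > 0, which cannot be e_D. *)

Set Implicit Arguments.
Unset Strict Implicit.
Unset Printing Implicit Defensive.

Import Order.TTheory GRing.Theory Num.Theory.
Local Open Scope ring_scope.

(** * Polynomials acting through a linear endomorphism *)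

HB.lock Definition pact (E : fieldType) (V : lmodType E) (f : {linear V -> V})
    (P : {poly E}) (v : V) : V := \sum_(i < size P) P`_i *: iter i f v.

Section PolyAction.
Variables (E : fieldType) (V : lmodType E).
Implicit Types (f g : {linear V -> V}) (P Q : {poly E}) (u v : V).

Lemma iter_is_linear f i : linear (iter i f).
Proof. by elim: i => [|i IHi] a u v //=; rewrite IHi linearP. Qed.

Lemma pactE k f P v : (size P <= k)%N ->
  pact f P v = \sum_(i < k) P`_i *: iter i f v.
Proof.
move=> Pk; rewrite pact.unlock (big_ord_widen _ (fun i => P`_i *: iter i f v) Pk).
rewrite big_mkcond; apply: eq_bigr => i _; case: ltnP => // /leq_sizeP -> //.
by rewrite scale0r.
Qed.

Lemma pact_is_linear f P : linear (pact f P).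
Proof.
move=> a u v; rewrite pact.unlock scaler_sumr -big_split; apply: eq_bigr => i _ /=.
by rewrite iter_is_linear scalerDr !scalerA mulrC.
Qed.

HB.instance Definition _ f P :=
  GRing.isLinear.Build E V V *:%R (pact f P) (pact_is_linear f P).

Lemma pactDr f P u v : pact f P (u + v) = pact f P u + pact f P v.
Proof. exact: linearD. Qed.

Lemma pactZr f P a v : pact f P (a *: v) = a *: pact f P v.
Proof. exact: linearZ. Qed.

Lemma pactD f P Q v : pact f (P + Q) v = pact f P v + pact f Q v.
Proof.
pose k := maxn (size P) (size Q).
rewrite !(@pactE k) ?leq_maxl ?leq_maxr ?size_polyD // -big_split.
by apply: eq_bigr => i _; rewrite coefD scalerDl.
Qed.

Lemma pactZ f a P v : pact f (a *: P) v = a *: pact f P v.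
Proof.
rewrite (pactE _ _ (size_scale_leq a P)) pact.unlock scaler_sumr.
by apply: eq_bigr => i _; rewrite coefZ scalerA.
Qed.

Lemma pactN f P v : pact f (- P) v = - pact f P v.
Proof. by rewrite -(scaleN1r P) pactZ scaleN1r. Qed.

Lemma pact0 f v : pact f 0 v = 0.
Proof. by rewrite pact.unlock size_poly0 big_ord0. Qed.

Lemma pact_sum f (I : Type) (r : seq I) (p : pred I) (F : I -> {poly E}) v :
  pact f (\sum_(i <- r | p i) F i) v = \sum_(i <- r | p i) pact f (F i) v.
Proof. exact: (big_morph (fun P => pact f P v) (fun P Q => pactD f P Q v) (pact0 f v)). Qed.

Lemma pactXn f i v : pact f 'X^i v = iter i f v.
Proof.
rewrite pact.unlock size_polyXn big_ord_recr big1 /= ?add0r ?coefXn ?eqxx ?scale1r //.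
by move=> j _; rewrite coefXn ltn_eqF ?scale0r.
Qed.

Lemma pactX f v : pact f 'X v = f v.
Proof. by rewrite -['X]expr1 pactXn. Qed.

Lemma pact1 f v : pact f 1 v = v.
Proof. by rewrite -(expr0 'X) pactXn. Qed.

Lemma pact_coef f P v : pact f P v = \sum_(i < size P) P`_i *: pact f 'X^i v.
Proof. by rewrite {1}pact.unlock; apply: eq_bigr => i _; rewrite pactXn. Qed.

Lemma pactXM f Q v : pact f ('X * Q) v = f (pact f Q v).
Proof.
rewrite (@pactE (size Q).+1); last first.
  by rewrite mulrC (leq_trans (size_polyMleq _ _)) // size_polyX addn2.
rewrite big_ord_recl coefXM eqxx scale0r add0r pact.unlock linear_sum.
by apply: eq_bigr => i _; rewrite coefXM /= linearZ.
Qed.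

Lemma pactM f P Q v : pact f (P * Q) v = pact f P (pact f Q v).
Proof.
elim/poly_ind: P => [|P c IHP]; first by rewrite mul0r !pact0.
rewrite mulrDl !pactD; congr (_ + _).
  by rewrite [P * 'X]mulrC -mulrA !pactXM IHP.
by rewrite mul_polyC pactZ -[c%:P]mulr1 mul_polyC pactZ pact1.
Qed.

Lemma pact_comp f P Q v : pact f (P \Po Q) v = pact (pact f Q) P v.
Proof.
elim/poly_ind: P v => [|P c IHP] v; first by rewrite comp_poly0 !pact0.
rewrite comp_polyD comp_polyM comp_polyX comp_polyC !pactD.
rewrite [_ * Q]mulrC [P * 'X]mulrC pactXM pactM IHP; congr (_ + _).
by rewrite -[c%:P]mulr1 mul_polyC !pactZ !pact1.
Qed.

Lemma pact_ker f P v : f v = 0 -> pact f P v = P`_0 *: v.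
Proof.
move=> fv; rewrite (pactE _ _ (leqnSn (size P))) big_ord_recl big1 ?addr0 // => i _.
by rewrite lift0 iterSr fv -pactXn linear0 scaler0.
Qed.

Lemma eq_pact f g P v : f =1 g -> pact f P v = pact g P v.
Proof. by move=> fg; rewrite pact.unlock; apply: eq_bigr => i _; rewrite (eq_iter fg). Qed.

End PolyAction.

Lemma pact_morph (E : fieldType) (V V' : lmodType E) (f : {linear V -> V})
    (g : {linear V' -> V'}) (k : {linear V -> V'}) (P : {poly E}) v :
  (forall u, k (f u) = g (k u)) -> k (pact f P v) = pact g P (k v).
Proof.
move=> kf; rewrite pact.unlock linear_sum; apply: eq_bigr => i _; rewrite linearZ /=.
by congr (_ *: _); elim: (i : nat) => //= j <-.
Qed.

(** * The Borel subgroup *)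

(** This is the upper right entry of the factorization in [borel_decomp], with [q] a power of p and
    [c] the lower right entry of [g]. *)
Lemma unip_entry (F : fieldType) (b c q r s : F) :
  c != 0 -> q != 0 -> q * c = r * s -> b = b * (q^-1 / c) * r * s.
Proof. by move=> c0 q0 qc; rewrite -(mulrA _ r) -qc -mulrA mulrACA !mulVf ?mulr1. Qed.

Section BorelIdentities.
Variables (p : nat) (p_pr : prime p).
Local Notation Zp := (padic_int p_pr).
Local Notation Qp := (padic p_pr).
Local Notation B := (borel Qp).
Local Notation KZ := (@borel_KZ p p_pr).
Local Notation ofZ := (@padic_of_int p p_pr).
Implicit Types (x y : Qp) (k : B).

Lemma padic_p_neq0 : p%:R != 0 :> Qp.
Proof. by rewrite -[_%:R]expr1 pX_neq0. Qed.

Lemma padic_of_int_nat (j : nat) : ofZ j%:R = j%:R.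
Proof. exact: rmorph_nat. Qed.

Lemma padic_residue_nat (z : Zp) N : exists (j : nat) z', z - j%:R = p%:R ^+ N * z'.
Proof.
have z0 : 0 <= z N by rewrite -residue_mod modz_ge0 ?q_neq0.
exists `|z N|%N; apply: padic_divX; apply/eqP.
rewrite -(@residue_eq0 _ _ _ N N) //.
rewrite -[X in (_ %| X)%Z]subr0; apply: (dvdz_sub_trans (residueD _ _ _)).
rewrite -[X in (_ %| _ - X)%Z](subrr (z N)).
apply: dvdz_subD (dvdz_subr _ _) _; apply: (dvdz_sub_trans (residueN _ _)).
by rewrite -opprD rpredN; have := residue_nat p_pr `|z N|%N N; rewrite gez0_abs.
Qed.

(** Modulo Z_p, [x] becomes a natural multiple of p^-N, so on a vector fixed by u(Z_p) the element
    [unip x] acts as a power of u(p^-N). *)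
Lemma padic_frac N x (z : Zp) : p%:R ^+ N * x = ofZ z ->
  exists (j : nat) (z' : Zp), x = p%:R ^- N *+ j + ofZ z'.
Proof.
move=> xz; have [j [z' zj]] := padic_residue_nat z N; exists j, z'.
apply: (mulfI (pX_neq0 p_pr N)); rewrite mulrDr xz -[_ *+ j]mulr_natl mulrCA.
rewrite mulfV ?pX_neq0 // mulr1 -(padic_of_int_nat j) -[z](subrK j%:R) zj addrC.
by rewrite rmorphD rmorphM rmorphXn rmorph_nat.
Qed.

Lemma unipD x y : unip (x + y) = (unip x * unip y)%g.
Proof.
by apply: borelE; rewrite ?borel_mulE00 ?borel_mulE01 ?borel_mulE11 !mxE /=;
  rewrite ?mul1r ?mulr1 // addrC.
Qed.

Lemma unip0 : unip (0 : Qp) = 1%g.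
Proof. by apply: borelE; rewrite !mxE. Qed.

Lemma diag_pD i j : diag_p p_pr (i + j) = (diag_p p_pr i * diag_p p_pr j)%g.
Proof.
by apply: borelE; rewrite ?borel_mulE00 ?borel_mulE01 ?borel_mulE11 !mxE /=;
  rewrite ?mul1r ?mulr0 ?mul0r ?addr0 ?exprD.
Qed.

Lemma diag_p_unip d x :
  (diag_p p_pr d * unip x)%g = (unip (x * p%:R ^- d)%R * diag_p p_pr d)%g.
Proof.
apply: borelE; rewrite ?borel_mulE00 ?borel_mulE01 ?borel_mulE11 !mxE /=;
  rewrite ?mul1r ?mulr1 ?mulr0 ?mul0r ?addr0 ?add0r //.
by rewrite divfK ?pX_neq0.
Qed.

Lemma torus_unip k x : k 0 1 = 0 ->
  (k * unip x)%g = (unip (k 0 0 / k 1 1 * x)%R * k)%g.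
Proof.
move=> k01; have /andP[_ k1] := borel_diag k.
apply: borelE; rewrite ?borel_mulE00 ?borel_mulE01 ?borel_mulE11 !mxE /= ?k01;
  rewrite ?mul1r ?mulr1 ?mulr0 ?mul0r ?addr0 ?add0r //.
by rewrite mulrAC divfK.
Qed.

Lemma torus_diag_p k d : k 0 1 = 0 -> (k * diag_p p_pr d)%g = (diag_p p_pr d * k)%g.
Proof.
move=> k01.
apply: borelE; rewrite ?borel_mulE00 ?borel_mulE01 ?borel_mulE11 !mxE /= ?k01;
  rewrite ?mul1r ?mulr1 ?mulr0 ?mul0r ?addr0 ?add0r //.
exact: mulrC.
Qed.

Lemma borel_Z_scalar x (x0 : x != 0) : borel_Z (borel_trig 0 x0 x0).
Proof.
move=> g; apply: borelE; rewrite !(borel_mulE00, borel_mulE01, borel_mulE11) !mxE /=;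
  rewrite ?mulr0 ?mul0r ?addr0 ?add0r mulrC //.
Qed.

Lemma KZ_unip (z : Zp) : KZ (unip (ofZ z)).
Proof.
exists (unip (ofZ z)).
  by split; rewrite mxE /=; [exists 1; rewrite ?rmorph1 //; exact: unitr1
    |exists 1; rewrite ?rmorph1 //; exact: unitr1|exists z].
exists 1%g; last by rewrite mulg1.
by move=> g; rewrite /commute mulg1 mul1g.
Qed.

Lemma KZ_torus k (y : Zp) : y \is a GRing.unit -> k 0 1 = 0 ->
  k 1 1 = k 0 0 * ofZ y -> KZ k.
Proof.
move=> yU k01 k11; have /andP[k0 _] := borel_diag k.
have y0 : ofZ y != 0.
  by rewrite tofrac_eq0; apply: contraTneq yU => ->; rewrite unitr0.
exists (borel_trig 0 (oner_neq0 _) y0).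
  split; rewrite mxE /=; [exists 1; rewrite ?rmorph1 //; exact: unitr1
    |by exists y|by exists 0; rewrite ?rmorph0].
exists (borel_trig 0 k0 k0); first exact: borel_Z_scalar.
apply: borelE; rewrite !(borel_mulE00, borel_mulE01, borel_mulE11) !mxE /= ?k01;
  rewrite ?mulr0 ?mul0r ?addr0 ?add0r ?mul1r // k11 mulrC //.
Qed.

(* Multiplying by a high power of [diag_p 1] removes all negative powers of [p]. *)
Lemma borel_decomp (g : B) : exists D0, forall D, (D0 <= D)%N ->
  exists x d k (y : Zp), [/\ y \is a GRing.unit, k 0 1 = 0,
    k 1 1 = k 0 0 * ofZ y &
    (diag_p p_pr D * g)%g = (unip x * diag_p p_pr d * k)%g].
Proof.
have decomp x : x != 0 -> exists i j (y : Zp),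
    y \is a GRing.unit /\ p%:R ^+ i * x = p%:R ^+ j * ofZ y.
  move=> x0; have [i [z xz]] := padic_denom x.
  have z0 : z != 0.
    apply/eqP => z0; move: xz; rewrite z0 rmorph0 => /eqP.
    by rewrite mulf_eq0 (negPf x0) orbF (negPf (pX_neq0 p_pr i)).
  have [j [y [yU zE]]] := padic_decomp z0.
  by exists i, j, y; split=> //; rewrite xz zE rmorphM rmorphXn rmorph_nat.
have /andP[g0 g1] := borel_diag g.
have [i1 [j1 [y1 [y1U e1]]]] := decomp _ g0.
have [i2 [j2 [y2 [y2U e2]]]] := decomp _ g1.
(* This bound keeps the subtraction in the exponent [D + j2 + i1 - i2 - j1] from being truncated. *)
exists (i2 + j1)%N => D leD.
have yU : y2 / y1 \is a GRing.unit by rewrite unitrM y2U unitrV.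
have y0 : ofZ (y2 / y1) != 0.
  by rewrite tofrac_eq0; apply: contraTneq yU => ->; rewrite unitr0.
pose k := borel_trig 0 g0 (mulf_neq0 g0 y0).
exists (g 0 1 * (p%:R ^- D / g 1 1)), (D + j2 + i1 - i2 - j1)%N, k, (y2 / y1).
split=> //; rewrite ?mxE //.
have key : p%:R ^+ D * g 1 1 = p%:R ^+ (D + j2 + i1 - i2 - j1) * (g 0 0 * ofZ (y2 / y1)).
  apply: (mulfI (pX_neq0 p_pr i2)); rewrite mulrCA e2.
  apply: (mulfI (pX_neq0 p_pr i1)).
  have -> : p%:R ^+ i1 * (p%:R ^+ i2 * (p%:R ^+ (D + j2 + i1 - i2 - j1) * (g 0 0 * ofZ (y2 / y1))))
    = p%:R ^+ (i2 + (D + j2 + i1 - i2 - j1)) * (p%:R ^+ i1 * g 0 0) * ofZ (y2 / y1) :> Qp.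
    by rewrite exprD; ring.
  rewrite e1 !mulrA -!exprD -mulrA -rmorphM mulrCA mulrV // mulr1.
  by congr (_ ^+ _ * _); lia.
apply: borelE; rewrite !(borel_mulE00, borel_mulE01, borel_mulE11) !mxE /=;
  rewrite ?mulr0 ?mul0r ?addr0 ?add0r ?mul1r ?mulr1 // -?key //.
exact: (unip_entry _ g1 (pX_neq0 p_pr D) key).
Qed.
End BorelIdentities.

(** * Unipotent differences *)

HB.instance Definition _ (E : fieldType) (G : groupType) (V : rep E G) g :=
  GRing.isLinear.Build E V V *:%R (@rep_act E G V g) (@rep_actP E G V g).

Lemma exprDpX (R : comNzRingType) (p : nat) (pR : p \in [pchar R]) (x y : R) a :
  (x + y) ^+ (p ^ a) = x ^+ (p ^ a) + y ^+ (p ^ a).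
Proof.
elim: a => [|a IHa]; first by rewrite !expr1.
by rewrite expnSr !exprM IHa -!(pFrobenius_autE pR) pFrobenius_autD_comm //; exact: mulrC.
Qed.

Section Unipotent.
Variables (p : nat) (p_pr : prime p) (E : fieldType).
Local Notation Zp := (padic_int p_pr).
Local Notation Qp := (padic p_pr).
Local Notation B := (borel Qp).
Local Notation KZ := (@borel_KZ p p_pr).
Local Notation ofZ := (@padic_of_int p p_pr).
Variable V : rep E B.
Implicit Types (x y : Qp) (k : B) (v w : V) (P : {poly E}).

Lemma rep_unipD x y v : rep_act (unip (x + y)) v = rep_act (unip x) (rep_act (unip y) v).
Proof. by rewrite unipD rep_actM. Qed.

Definition dif x v : V := rep_act (unip x) v - v.

Lemma dif_is_linear x : linear (dif x).
Proof. by move=> a u v; rewrite /dif linearP scalerBr opprD addrACA. Qed.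

HB.instance Definition _ x := GRing.isLinear.Build E V V *:%R (dif x) (dif_is_linear x).

Lemma unip_pact x j v :
  rep_act (unip (x *+ j)) v = pact (dif x) (('X + 1) ^+ j) v.
Proof.
elim: j => [|j IHj]; first by rewrite mulr0n unip0 rep_act1 pact1.
by rewrite mulrS rep_unipD IHj exprS mulrDl mul1r pactD pactXM /dif subrK.
Qed.

Lemma dif_pact x j v : dif (x *+ j) v = pact (dif x) (('X + 1) ^+ j - 1) v.
Proof. by rewrite /dif unip_pact pactD pactN pact1. Qed.

Lemma unip_dif x y v : rep_act (unip x) (dif y v) = dif y (rep_act (unip x) v).
Proof. by rewrite /dif linearB /= -!rep_unipD [y + x]addrC. Qed.

Lemma unip_pactC x y P v :
  rep_act (unip x) (pact (dif y) P v) = pact (dif y) P (rep_act (unip x) v).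
Proof. exact/pact_morph/unip_dif. Qed.

(** With y = p^-(N+a) one has u(p^-N) = u(y)^(p^a), and in characteristic p subtracting 1 commutes
    with taking p^a-th powers. *)
Lemma dif_raise (pE : p \in [pchar E]) N a v :
  dif (p%:R ^- N) v = pact (dif (p%:R ^- (N + a))) 'X^(p ^ a) v.
Proof.
have -> : p%:R ^- N = (p%:R ^- (N + a)) *+ (p ^ a) :> Qp.
  by rewrite -[RHS]mulr_natl natrX exprD invfM mulrCA mulfV ?mulr1 ?pX_neq0.
have pP : p \in [pchar {poly E}] by rewrite pchar_poly.
by rewrite dif_pact (exprDpX pP) expr1n addrK.
Qed.

Lemma pact_raise (pE : p \in [pchar E]) N a P v :
  pact (dif (p%:R ^- N)) P v =
  pact (dif (p%:R ^- (N + a))) (P \Po 'X^(p ^ a)) v.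
Proof. by rewrite pact_comp; apply: eq_pact => u; apply: dif_raise. Qed.

Lemma torus_pact k x P v : k 0 1 = 0 ->
  rep_act k (pact (dif x) P v) = pact (dif (k 0 0 / k 1 1 * x)) P (rep_act k v).
Proof.
move=> k01; apply: pact_morph => u.
by rewrite /dif linearB /= -!rep_actM torus_unip // rep_actM.
Qed.

Lemma diag_pact d N P v :
  rep_act (diag_p p_pr d) (pact (dif (p%:R ^- N)) P v) =
  pact (dif (p%:R ^- (d + N))) P (rep_act (diag_p p_pr d) v).
Proof.
apply: pact_morph => u.
rewrite /dif linearB /= -!rep_actM diag_p_unip rep_actM.
by rewrite -invfM -exprD [(N + d)%N]addnC.
Qed.

(** Unipotents commute, so u(x-y) fixes every iterate of [dif y] on [v]; on such vectors u(x) and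
    u(y) agree. *)
Lemma dif_congr x y P v :
  rep_act (unip (x - y)) v = v -> pact (dif x) P v = pact (dif y) P v.
Proof.
move=> xyv; rewrite pact.unlock; apply: eq_bigr => i _; congr (_ *: _).
have xyi j : rep_act (unip (x - y)) (iter j (dif y) v) = iter j (dif y) v.
  by rewrite -pactXn unip_pactC xyv.
elim: (i : nat) => //= j ->.
by rewrite /dif -{1}[x](subrK y) [x - y + y]addrC rep_unipD xyi.
Qed.
End Unipotent.

(** * Vectors on which KZ acts through the character sigma *)

Section Spherical.
Variables (p : nat) (p_pr : prime p) (E : fieldType).
Variables (sigma1 sigma2 : smooth_char p_pr E).
Local Notation Zp := (padic_int p_pr).
Local Notation Qp := (padic p_pr).
Local Notation B := (borel Qp).
Local Notation KZ := (@borel_KZ p p_pr).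
Local Notation ofZ := (@padic_of_int p p_pr).
Local Notation sigma := (sigma sigma1 sigma2).

Lemma schar1 (chi : smooth_char p_pr E) : chi 1 = 1.
Proof.
have c0 := schar_neq0 chi (oner_neq0 _).
apply: (mulfI c0); rewrite mulr1 -(scharM chi) ?oner_neq0 // mulr1 //.
Qed.

Lemma sigma_neq0 (g : B) : sigma g != 0.
Proof. have /andP[g0 g1] := borel_diag g.
exact: (mulf_neq0 (schar_neq0 sigma1 g0) (schar_neq0 sigma2 g1)).
Qed.

Lemma sigma_unip (x : Qp) : sigma (unip x) = 1.
Proof. by rewrite /Defs.sigma !mxE /= !schar1 mulr1. Qed.

Variables (V : rep E B) (e : V).
Hypothesis eK : forall k, KZ k -> rep_act k e = sigma k *: e.
Hypothesis pE : p \in [pchar E].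
Implicit Types (x y : Qp) (k : B) (v w : V) (P : {poly E}).

Definition level_vec d : V := rep_act (diag_p p_pr d) e.

Lemma diag_e_ i d : rep_act (diag_p p_pr i) (level_vec d) = level_vec (i + d).
Proof. by rewrite /level_vec diag_pD rep_actM. Qed.

(** Conjugation by diag(1,p^d) carries u(Z_p), which fixes [e], to u(p^-d Z_p). *)
Lemma unip_e_ d x (z : Zp) : p%:R ^+ d * x = ofZ z -> rep_act (unip x) (level_vec d) = level_vec d.
Proof.
move=> xz; have -> : x = ofZ z * p%:R ^- d by rewrite -xz mulrAC mulfV ?mul1r ?pX_neq0.
rewrite /level_vec -rep_actM -diag_p_unip rep_actM eK ?sigma_unip ?scale1r //.
exact: KZ_unip.
Qed.

Lemma dif_e_ d : dif (p%:R ^- d) (level_vec d) = 0.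
Proof. by rewrite /dif (@unip_e_ _ _ 1) ?subrr // mulfV ?pX_neq0 // rmorph1. Qed.

Lemma torus_e_ k d : KZ k -> k 0 1 = 0 -> rep_act k (level_vec d) = sigma k *: level_vec d.
Proof. by move=> kK k01; rewrite /level_vec -rep_actM torus_diag_p // rep_actM eK // linearZ. Qed.

Lemma difX_e_ N d t : (d <= N)%N -> (p ^ (N - d) <= t)%N ->
  pact (dif (p%:R ^- N)) 'X^t (level_vec d) = 0.
Proof.
move=> dN tN; rewrite -(subnK tN) exprD pactM.
by have := dif_raise pE d (N - d) (level_vec d); rewrite subnKC // => <-; rewrite dif_e_ linear0.
Qed.

(** Conjugation by [k] turns u(p^-N) into u(z p^-N). This differs from u(g p^-N) by an element of
    u(Z_p), which fixes the level vector, and u(g p^-N) is (1 + X)^g. *)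
Lemma torus_pact_e_ k N d P (z : Zp) (g : nat) : KZ k -> k 0 1 = 0 ->
  k 0 0 / k 1 1 = ofZ z -> (exists z', z - g%:R = p%:R ^+ N * z') ->
  rep_act k (pact (dif (p%:R ^- N)) P (level_vec d)) =
  sigma k *: pact (dif (p%:R ^- N)) (P \Po (('X + 1) ^+ g - 1)) (level_vec d).
Proof.
move=> kK k01 kz [z' zg]; rewrite torus_pact // torus_e_ // linearZ /= kz.
congr (_ *: _); rewrite pact_comp -(eq_pact _ _ (dif_pact _ _)).
apply: dif_congr; apply: (@unip_e_ _ _ (p%:R ^+ d * z')).
rewrite -[_ *+ g]mulr_natl -mulrBl -(padic_of_int_nat _ g) -rmorphB zg !rmorphM !rmorphXn.
by rewrite !rmorph_nat [p%:R ^+ N * _]mulrC mulfK ?pX_neq0.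
Qed.

Lemma unip_integral_e_ d (z : Zp) : rep_act (unip (ofZ z)) (level_vec d) = level_vec d.
Proof.
apply: (@unip_e_ _ _ (p%:R ^+ d * z)).
by rewrite rmorphM rmorphXn rmorph_nat.
Qed.
End Spherical.

(** * Arithmetic of primitive exponents *)

Section PrimitiveArithmetic.
Local Open Scope nat_scope.

Lemma coprime_pred_exp p n k : prime p -> 0 < n -> coprime (p ^ n).-1 (p ^ k).
Proof.
move=> p_pr n0; apply: coprimeXr; rewrite coprime_sym.
have q0 : 0 < p ^ n by rewrite expn_gt0 prime_gt0.
rewrite prime_coprime //; apply/negP => pd.
have : p %| p ^ n by rewrite dvdn_exp.
rewrite -(prednK q0) -addn1 dvdn_addr // dvdn1 => /eqP p1.
by rewrite p1 in p_pr.
Qed.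

(** Let g = gcd(a,n), with au = nv + g. Then p^(au) - 1 = p^(nv) (p^g - 1) + (p^(nv) - 1), so p^n -
    1 would divide h (p^g - 1), and the divisor g of n would contradict primitivity. *)
Lemma primitive_not_dvdn p n h a : prime p -> primitive p n h -> 0 < a -> a < n ->
  ~~ ((p ^ n).-1 %| h * (p ^ a).-1).
Proof.
move=> p_pr [h1 hle prim] a0 an; apply/negP => dv; apply: prim.
have pgt0 i : 0 < p ^ i by rewrite expn_gt0 prime_gt0.
have n0 : 0 < n by apply: leq_ltn_trans an.
exists (gcdn a n); split.
- by apply: leq_ltn_trans an; apply: dvdn_leq (dvdn_gcdl _ _).
- exact: dvdn_gcdr.
have [u v uv _] := egcdnP n a0.
set g := gcdn a n in uv *.
have g0 : 0 < g by rewrite gcdn_gt0 a0.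
have dvg : (p ^ n).-1 %| h * (p ^ g).-1.
  have du : (p ^ n).-1 %| h * (p ^ (a * u)).-1.
    by apply: dvdn_trans dv _; rewrite dvdn_mul // expnM dvdn_pred_predX.
  have dvn : (p ^ n).-1 %| h * (p ^ (n * v)).-1.
    by rewrite dvdn_mull // expnM dvdn_pred_predX.
  rewrite -(Gauss_dvdr _ (coprime_pred_exp (n * v) p_pr n0)).
  have e : h * (p ^ (a * u)).-1 = p ^ (n * v) * (h * (p ^ g).-1) + h * (p ^ (n * v)).-1.
    rewrite [a * u]mulnC uv [v * n]mulnC expnD.
    have := pgt0 (n * v); have := pgt0 g.
    case: (p ^ g) => // G _; case: (p ^ (n * v)) => // P _.
    by rewrite mulSn addSn /=; ring.
  by rewrite e dvdn_addl in du.
have dgn : (p ^ g).-1 %| (p ^ n).-1.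
  by rewrite -[in X in _ %| X](divnK (dvdn_gcdr a n)) mulnC expnM dvdn_pred_predX.
rewrite !subn1.
have pg0 : 0 < (p ^ g).-1.
  by rewrite -ltnS prednK // -(expn0 p) ltn_exp2l ?prime_gt1.
by rewrite -(dvdn_pmul2r pg0) divnK.
Qed.

(** For two monomials of equal depth [d], the exponents differ modulo p - 1, so the torus can
    separate them. Subtracting the depth equations gives (ti - tj)(q - 1) = m p^(N-j) (p^(j-i) - 1).
    If p - 1 divided ti - tj, replacing m by q - 1 - h(p-1) and cancelling p - 1 and the power of p
    would make q - 1 divide h (p^(j-i) - 1). *)
Lemma primitive_sep p n h m d N i j ti tj : prime p -> primitive p n h ->
  m + h * p.-1 = (p ^ n).-1 -> i < j -> j < n -> n <= N ->
  p ^ (N - i) * m = ti * (p ^ n).-1 + d -> p ^ (N - j) * m = tj * (p ^ n).-1 + d ->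
  tj <= ti /\ ~~ (p.-1 %| ti - tj).
Proof.
move=> p_pr prim mE ij jn nN iE jE.
have pgt0 k : 0 < p ^ k by rewrite expn_gt0 prime_gt0.
have p1 : 0 < p.-1 by rewrite -ltnS prednK ?prime_gt1 ?prime_gt0.
have n0 : 0 < n by apply: leq_ltn_trans jn.
have q1 : 0 < (p ^ n).-1 by rewrite -ltnS prednK // -(expn0 p) ltn_exp2l ?prime_gt1.
have a0 : 0 < j - i by rewrite subn_gt0.
have an : j - i < n by apply: leq_ltn_trans (leq_subr _ _) jn.
have NiE : N - i = (N - j) + (j - i) by lia.
have le_t : tj <= ti.
  rewrite -(leq_pmul2r q1) -(leq_add2r d) -iE -jE leq_mul2r.
  by rewrite leq_pexp2l ?prime_gt0 ?orbT // NiE leq_addr.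
split=> //; apply/negP => dt; move/negP: (primitive_not_dvdn p_pr prim a0 an); apply.
rewrite -(Gauss_dvdr _ (coprime_pred_exp (N - j) p_pr n0)).
rewrite -(dvdn_pmul2r p1).
have diff : (ti - tj) * (p ^ n).-1 + h * p.-1 * (p ^ (N - j) * (p ^ (j - i)).-1)
    = (p ^ n).-1 * (p ^ (N - j) * (p ^ (j - i)).-1).
  have : (ti - tj) * (p ^ n).-1 = m * (p ^ (N - j) * (p ^ (j - i)).-1).
    rewrite mulnBl -(subnDr d) -iE -jE NiE expnD -mulnBl mulnC; congr (_ * _).
    by rewrite -subn1 mulnBr muln1.
  by move=> ->; rewrite -mulnDl mE.
have -> : p ^ (N - j) * (h * (p ^ (j - i)).-1) * p.-1
    = h * p.-1 * (p ^ (N - j) * (p ^ (j - i)).-1).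
  by rewrite mulnCA -!mulnA [X in _ = _ * X]mulnC -!mulnA.
have dp : p.-1 %| (p ^ (j - i)).-1 by exact: dvdn_pred_predX.
have d2 : (p ^ n).-1 * p.-1 %| (p ^ n).-1 * (p ^ (N - j) * (p ^ (j - i)).-1).
  by rewrite dvdn_mul // dvdn_mull.
by move: d2; rewrite -diff dvdn_addr // mulnC dvdn_mul.
Qed.
End PrimitiveArithmetic.

Lemma natr_fermat (p : nat) (E : fieldType) (g : nat) : p \in [pchar E] ->
  (g%:R : E) != 0 -> (g%:R : E) ^+ p.-1 = 1.
Proof.
move=> pE gn0; apply: (mulfI gn0).
rewrite mulr1 -exprS prednK ?prime_gt0 ?(pcharf_prime pE) //.
by rewrite -(pFrobenius_autE pE) pFrobenius_aut_nat.
Qed.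

(** Otherwise the p - 1 nonzero elements of the prime field would all be roots of X^r - 1, where r
    is the nonzero remainder of [d] modulo p - 1. *)
Lemma natr_exp_neq1 (p : nat) (E : fieldType) (d : nat) : p \in [pchar E] ->
  ~~ (p.-1 %| d)%N -> exists g, [/\ (0 < g)%N, (g < p)%N & (g%:R : E) ^+ d != 1].
Proof.
move=> pE nd; have p_pr := pcharf_prime pE.
have p1 : (0 < p.-1)%N by rewrite -ltnS prednK ?prime_gt1 ?prime_gt0.
have pK : p.-1.+1 = p by rewrite prednK ?prime_gt0.
pose r := (d %% p.-1)%N.
have r0 : (0 < r)%N by rewrite lt0n.
have rp : (r < p.-1)%N by rewrite ltn_mod.
have fermat g : (0 < g)%N -> (g < p)%N -> (g%:R : E) ^+ p.-1 = 1.
  by move=> g0 gp; apply: natr_fermat => //; rewrite -(dvdn_pcharf pE) gtnNdvd.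
pose rs : seq E := [seq g%:R | g <- iota 1 p.-1].
have [/hasP[g gI gd]|/hasPn all1] := boolP (has (fun g => (g%:R : E) ^+ d != 1) (iota 1 p.-1)).
  move: gI; rewrite mem_iota add1n pK => /andP[g0 gp].
  by exists g.
have rs_uniq : uniq rs.
  rewrite map_inj_in_uniq ?iota_uniq // => a b; rewrite !mem_iota !add1n pK.
  wlog ab : a b / (a <= b)%N.
    by move=> H aI bI ab; case/orP: (leq_total a b) => le;
      [exact: H|apply/esym/H].
  move=> /andP[a0 ap] /andP[b0 bp] /eqP; rewrite eq_sym -subr_eq0 -natrB //.
  rewrite -(dvdn_pcharf pE) => dv; apply/eqP; rewrite eqn_leq ab /=.
  rewrite -subn_eq0; apply: contraTT dv; rewrite -lt0n => ba.
  by rewrite gtnNdvd // (leq_ltn_trans (leq_subr _ _)).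
have rs_root : all (root ('X^r - 1)) rs.
  apply/allP => _ /mapP[g gI ->]; rewrite rootE !hornerE subr_eq0.
  have := all1 g gI; rewrite negbK {1}(divn_eq d p.-1) exprD (mulnC _ p.-1) exprM.
  move: gI; rewrite mem_iota add1n pK => /andP[g0 gp].
  by rewrite fermat // expr1n mul1r.
have Xr0 : 'X^r - 1 != 0 :> {poly E} by rewrite -size_poly_eq0 size_XnsubC.
have := max_poly_roots Xr0 rs_root rs_uniq.
by rewrite size_map size_iota size_XnsubC // ltnS leqNgt rp.
Qed.

(** * Representations generated by a spherical vector with the tower relation *)

Section Tower.
Variables (p : nat) (p_pr : prime p) (E : fieldType).
Variables (sigma1 sigma2 : smooth_char p_pr E).
Local Notation Zp := (padic_int p_pr).
Local Notation Qp := (padic p_pr).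
Local Notation B := (borel Qp).
Local Notation KZ := (@borel_KZ p p_pr).
Local Notation ofZ := (@padic_of_int p p_pr).
Local Notation sigma := (sigma sigma1 sigma2).
Variables (V : rep E B) (e : V).
Hypothesis eK : forall k, KZ k -> rep_act k e = sigma k *: e.
Hypothesis pE : p \in [pchar E].
Local Notation e_ := (level_vec e).
Local Notation X N := (dif (V := V) (p%:R ^- N)).
Implicit Types (x y : Qp) (v w : V).

Variables (n m : nat) (kap : E) (x0 : Qp).
Hypothesis n_gt0 : (0 < n)%N.
Hypothesis m_gt0 : (0 < m)%N.
Variable h : nat.
Hypothesis prim : primitive p n h.
Hypothesis mE : (m + h * p.-1 = (p ^ n).-1)%N.
Hypothesis m_lt : (m < (p ^ n).-1)%N.
Hypothesis kap_neq0 : kap != 0.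
Hypothesis rel : e_ n = kap *: rep_act (unip x0) (pact (X n) 'X^m (e_ 0)).

Lemma pexp_gt0 i : (0 < p ^ i)%N.
Proof. by rewrite expn_gt0 prime_gt0. Qed.

Lemma relD d :
  e_ (d + n) = kap *: rep_act (unip (x0 * p%:R ^- d)) (pact (X (d + n)) 'X^m (e_ d)).
Proof.
rewrite -diag_e_ rel linearZ /= -rep_actM diag_p_unip rep_actM; congr (_ *: rep_act _ _).
by rewrite diag_pact diag_e_ addn0.
Qed.

Lemma pactX_raise N a t v :
  pact (X N) 'X^t v = pact (X (N + a)) 'X^(p ^ a * t) v.
Proof. by rewrite (pact_raise pE _ a) comp_Xn_poly -exprM. Qed.

(** Each application of [relD] multiplies the exponent by q, because the level rises by n, and adds
    m. Thus s = m (1 + q + ... + q^(k-1)); the equation on [s] encodes this geometric sum. *)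
Lemma relX k d : exists c x s, [/\ c != 0, (s * (p ^ n).-1 + m = p ^ (k * n) * m)%N &
  e_ (d + k * n) = c *: rep_act (unip x) (pact (X (d + k * n)) 'X^s (e_ d))].
Proof.
elim: k => [|k [c [x [s [c0 sE eE]]]]].
  exists 1, 0, 0%N; split; rewrite ?oner_neq0 ?mul1n //.
  by rewrite addn0 unip0 rep_act1 pact1 scale1r.
exists (kap * c), (x0 * p%:R ^- (d + k * n) + x), (m + s * p ^ n)%N; split.
- exact: mulf_neq0.
- have := pexp_gt0 n; rewrite mulSn expnD; move: sE.
  case: (p ^ n)%N => // q /= sE _.
  by rewrite -mulnA -sE; ring.
rewrite mulSn [(n + _)%N]addnC addnA relD {1}eE !linearZ /= scalerA [c * kap]mulrC; congr (_ *: _).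
have -> : pact (X (d + k * n + n)) 'X^(m + s * p ^ n) (e_ d) =
    pact (X (d + k * n + n)) 'X^m (pact (X (d + k * n)) 'X^s (e_ d)).
  by rewrite (exprD _ m) pactM (mulnC s) -(pactX_raise _ n).
by rewrite rep_unipD -[in LHS]unip_pactC.
Qed.

(** After N steps of the tower the level d + Nn is at least N, and the vector there is a unit times
    a translate of X^s e_d. It is killed by X at its own level, so X^(s+1) e_d = 0, and the
    inequality says that the exponent p^a t at that level exceeds s. *)
Lemma pactX_e_eq0 N d t : (d <= N)%N ->
  (p ^ (N - d) * m < t * (p ^ n).-1)%N -> pact (X N) 'X^t (e_ d) = 0.
Proof.
move=> dN tN; have [c [x [s [c0 sE eE]]]] := relX N d.
have leN : (N <= d + N * n)%N by rewrite (leq_trans (leq_pmulr N n_gt0)) ?leq_addl.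
pose a := (d + N * n - N)%N.
have NaE : (N + a = d + N * n)%N by rewrite subnKC.
have st : (s < p ^ a * t)%N.
  rewrite -(@ltn_pmul2r (p ^ n).-1) ?(leq_ltn_trans _ m_lt) //.
  apply: (@leq_ltn_trans (p ^ (N * n) * m)); first by rewrite -sE leq_addr.
  have -> : (N * n = a + (N - d))%N by rewrite /a; lia.
  by rewrite expnD -!mulnA ltn_pmul2l ?pexp_gt0.
rewrite (pactX_raise _ a) NaE -(subnK st) -addSnnS (exprD 'X) pactM.
have eE' : pact (X (d + N * n)) 'X^s (e_ d) =
    c^-1 *: rep_act (unip (- x)) (e_ (d + N * n)).
  rewrite eE linearZ /= -rep_unipD addNr unip0 rep_act1.
  by rewrite scalerA mulVf ?scale1r.
rewrite eE' linearZ /= -unip_pactC (exprSr 'X) pactM pactX /= (dif_e_ eK).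
by rewrite !linear0.
Qed.

(** By the tower relation e_d comes from e_(d mod n), so indices below n suffice. *)
Definition comb N (P : nat -> {poly E}) : V := \sum_(i < n) pact (X N) (P i) (e_ i).

Lemma combD N (P Q : nat -> {poly E}) : comb N (fun i => P i + Q i) = comb N P + comb N Q.
Proof. by rewrite -big_split; apply: eq_bigr => i _; rewrite pactD. Qed.

Lemma combZ N a (P : nat -> {poly E}) : comb N (fun i => a *: P i) = a *: comb N P.
Proof. by rewrite /comb scaler_sumr; apply: eq_bigr => i _; rewrite pactZ. Qed.

Lemma comb_pact N R (P : nat -> {poly E}) : pact (X N) R (comb N P) = comb N (fun i => R * P i).
Proof. by rewrite /comb linear_sum; apply: eq_bigr => i _; rewrite pactM. Qed.

Lemma comb_raise N a (P : nat -> {poly E}) : comb N P = comb (N + a) (fun i => P i \Po 'X^(p ^ a)).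
Proof. by apply: eq_bigr => i _; exact: pact_raise. Qed.

Lemma unip_e_pact N x d (z : Zp) : p%:R ^+ N * x = ofZ z ->
  exists j, rep_act (unip x) (e_ d) = pact (X N) (('X + 1) ^+ j) (e_ d).
Proof.
move=> /padic_frac[j [z' ->]]; exists j.
by rewrite -unip_pact rep_unipD (unip_integral_e_ eK).
Qed.

(** Write d as its remainder modulo n plus a multiple of n and apply [relX]. Allowing every large
    [N] lets several vectors be expressed at a common level. *)
Lemma unip_e_comb d x : exists N0, forall N, (N0 <= N)%N ->
  exists P, rep_act (unip x) (e_ d) = comb N P.
Proof.
have [c [x' [s [c0 _ eE]]]] := relX (d %/ n) (d %% n).
have dE : (d %% n + d %/ n * n = d)%N by rewrite addnC -divn_eq.
rewrite dE in eE; have [M [z xz]] := padic_denom (x + x').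
exists (d + M)%N => N leN.
have [j jE] : exists j, rep_act (unip (x + x')) (e_ (d %% n)) =
    pact (X N) (('X + 1) ^+ j) (e_ (d %% n)).
  apply: (@unip_e_pact _ _ _ (p%:R ^+ (N - M) * z)).
  rewrite rmorphM rmorphXn rmorph_nat /= -xz mulrA -exprD subnK //.
  exact: leq_trans (leq_addl _ _) leN.
have dn : (d %% n < n)%N by rewrite ltn_mod.
exists (fun i => if i == (d %% n)%N then
  c *: ('X^(p ^ (N - d) * s) * ('X + 1) ^+ j) else 0).
rewrite /comb (bigD1 (Ordinal dn)) //= eqxx big1 ?addr0 => [|i ne]; last first.
  by rewrite -val_eqE /= in ne; rewrite (negPf ne) pact0.
rewrite eE linearZ /= -rep_unipD pactZ unip_pactC pactM -jE; congr (_ *: _).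
rewrite (pactX_raise _ (N - d)) subnKC //.
exact: leq_trans (leq_addr _ _) leN.
Qed.

Hypothesis e_gen : forall v, exists s : seq (E * B), v = \sum_(c <- s) c.1 *: rep_act c.2 e.

Lemma comb_span v : exists D N P, (n <= N)%N /\ rep_act (diag_p p_pr D) v = comb N P.
Proof.
have [s ->] := e_gen v.
(* The claim is strengthened to all large [D] and [N], so that in the induction the new summand and
   the rest of the sum share both. *)
suff [D0 HD] : exists D0, forall D, (D0 <= D)%N -> exists N0, forall N, (N0 <= N)%N ->
    exists P, rep_act (diag_p p_pr D) (\sum_(c <- s) c.1 *: rep_act c.2 e) = comb N P.
  have [N0 HN] := HD D0 (leqnn _); have [P PE] := HN (N0 + n)%N (leq_addr _ _).
  by exists D0, (N0 + n)%N, P; rewrite leq_addl.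
elim: s => [|[a g] s [D1 IH]].
  exists 0%N => D _; exists 0%N => N _; exists (fun=> 0).
  by rewrite big_nil linear0 /comb big1 // => i _; rewrite pact0.
have [D2 HD2] := borel_decomp g.
exists (D1 + D2)%N => D leD.
have [N1 {}IH] := IH D (leq_trans (leq_addr _ _) leD).
have [x [d [k [y [yU k01 k11 gE]]]]] := HD2 D (leq_trans (leq_addl _ _) leD).
have [N2 HN2] := unip_e_comb d x.
exists (N1 + N2)%N => N leN.
have [P PE] := IH N (leq_trans (leq_addr _ _) leN).
have [Q QE] := HN2 N (leq_trans (leq_addl _ _) leN).
exists (fun i => (a * sigma k) *: Q i + P i); rewrite combD combZ -PE -QE.
rewrite big_cons linearD linearZ /= -rep_actM gE !rep_actM (eK (KZ_torus yU k01 k11)).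
by rewrite !linearZ /= scalerA mulrC.
Qed.

(* [depth N i] is the depth of [e_ i] itself; [texp N d i] is the exponent that brings it down
   to [d], meaningful only under [at_depth]. *)
Definition depth N i := (p ^ (N - i) * m)%N.
Definition texp N d i := ((depth N i - d) %/ (p ^ n).-1)%N.
Definition at_depth N d i := (d <= depth N i)%N && ((p ^ n).-1 %| depth N i - d)%N.
Definition lead N d (P : nat -> {poly E}) i : E :=
  if at_depth N d i then (P i)`_(texp N d i) else 0.
Definition mono N d (al : nat -> E) i : {poly E} := al i *: 'X^(texp N d i).
(** This excludes the indices where [texp] is a meaningless quotient, so every nonzero term of
    [comb N (mono N d al)] has depth exactly [d]. *)
Definition homog N d (al : nat -> E) := forall i, (i < n)%N -> al i != 0 -> at_depth N d i.

Lemma texpP N d i : at_depth N d i -> depth N i = (texp N d i * (p ^ n).-1 + d)%N.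
Proof. by case/andP => dN dv; rewrite divnK // subnK. Qed.

Lemma texp_eq N d i t : depth N i = (t * (p ^ n).-1 + d)%N -> at_depth N d i /\ texp N d i = t.
Proof.
move=> dE; rewrite /at_depth /texp dE addnK dvdn_mull // leq_addl mulnK //.
exact: leq_ltn_trans m_lt.
Qed.

Lemma depth_raise N a i : (i <= N)%N -> depth (N + a) i = (p ^ a * depth N i)%N.
Proof. by move=> iN; rewrite /depth mulnA -expnD addnC addnBA. Qed.

(* Multiplying by [X^r] at a finer level pushes every monomial of non-maximal depth past
   the annihilator of [e_ i]. *)
Lemma homogenize N d (P : nat -> {poly E}) : (n <= N)%N -> (0 < d)%N ->
  (forall i t, (i < n)%N -> (P i)`_t != 0 -> (depth N i <= t * (p ^ n).-1 + d)%N) ->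
  exists N' d' r, [/\ (n <= N')%N, (0 < d')%N, homog N' d' (lead N d P) &
    comb N' (mono N' d' (lead N d P)) = pact (X N') 'X^r (comb N P)].
Proof.
move=> nN d0 Pd; have q1 : (0 < (p ^ n).-1)%N by exact: leq_ltn_trans m_lt.
have qE : (p ^ n = (p ^ n).-1.+1)%N by rewrite prednK // pexp_gt0.
(* Raising the level by n multiplies depths by q. Dividing qd - 1 rather than qd gives qd = r(q-1) +
   d' with 1 <= d' <= q - 1: then X^r takes the maximal depth to d' > 0 and any smaller depth to at
   most d' - q < 0. *)
pose r := ((p ^ n * d).-1 %/ (p ^ n).-1)%N.
pose d' := (((p ^ n * d).-1 %% (p ^ n).-1).+1)%N.
have rE : (p ^ n * d = r * (p ^ n).-1 + d')%N.
  by rewrite /d' addnS -divn_eq prednK // muln_gt0 pexp_gt0.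
have d'q : (d' < p ^ n)%N by rewrite qE ltnS ltn_mod.
have shift i t : (i < n)%N -> depth N i = (t * (p ^ n).-1 + d)%N ->
    depth (N + n) i = ((p ^ n * t + r) * (p ^ n).-1 + d')%N.
  move=> iN tE; rewrite depth_raise ?(leq_trans (ltnW iN)) // tE.
  by rewrite mulnDr rE mulnDl mulnA addnA.
exists (N + n)%N, d', r; split; rewrite ?leq_addl //.
  move=> i iN; rewrite /lead; case: ifP => [/texpP/(shift _ _ iN)/texp_eq[]//|_].
  by rewrite eqxx.
rewrite (comb_raise N n P) comb_pact; apply: eq_bigr => -[i iN] _ /=.
rewrite pactM -(pact_raise pE) /mono pactZ [in RHS](pact_coef _ (P i)) linear_sum /=.
have term t : pact (X (N + n)) 'X^r ((P i)`_t *: pact (X N) 'X^t (e_ i)) =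
    (P i)`_t *: pact (X (N + n)) 'X^(p ^ n * t + r) (e_ i).
  by rewrite linearZ /= (pactX_raise N n) (addnC _ r) (exprD 'X) pactM.
have term0 t : depth N i != (t * (p ^ n).-1 + d)%N ->
    (P i)`_t *: pact (X (N + n)) 'X^(p ^ n * t + r) (e_ i) = 0.
  have [->|Pt0] := eqVneq (P i)`_t 0; first by rewrite scale0r.
  have := Pd i t iN Pt0; rewrite leq_eqVlt => /orP[-> //|tlt] _.
  rewrite pactX_e_eq0 ?scaler0 //.
    by rewrite (leq_trans (ltnW iN)) // (leq_trans nN) ?leq_addr.
  rewrite -/(depth (N + n) i) depth_raise ?(leq_trans (ltnW iN)) //.
  rewrite mulnDl -mulnA -(ltn_add2r d') -addnA -rE -mulnDr.
  apply: (@leq_trans (p ^ n * (depth N i).+1)); first by rewrite mulnS addnC ltn_add2r.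
  by rewrite leq_mul2l tlt orbT.
under eq_bigr do rewrite term.
rewrite /lead; case: ifP => [ati|nati]; last first.
  rewrite scale0r big1 // => t _; apply: term0.
  by apply/eqP => /texp_eq[]; rewrite nati.
have tE := texpP ati; have [_ ->] := texp_eq (shift _ _ iN tE).
have uniq_t t : t != texp N d i -> depth N i != (t * (p ^ n).-1 + d)%N.
  by apply: contra_neq => /texp_eq[_ ->].
have [szP|szP] := ltnP (texp N d i) (size (P i)).
  rewrite (bigD1 (Ordinal szP)) //= big1 ?addr0 // => t tne.
  exact/term0/uniq_t.
rewrite nth_default // scale0r big1 // => t _; apply/term0/uniq_t.
by rewrite neq_ltn (leq_trans (ltn_ord t) szP).
Qed.

Lemma coef_unip_pow (g t j : nat) : (((('X + 1) ^+ g - 1) ^+ t : {poly E})`_j =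
  if (j < t)%N then 0 else ((\sum_(i < g) ('X + 1) ^+ i) ^+ t)`_(j - t)).
Proof. by rewrite subrX1 addrK exprMn coefXnM. Qed.

(** (1 + X)^g - 1 is X times a polynomial with constant term g. *)
Lemma coef_unip_pow_lead (g t : nat) : (((('X + 1) ^+ g - 1) ^+ t : {poly E})`_t = g%:R ^+ t).
Proof.
rewrite coef_unip_pow ltnn subnn -horner_coef0 horner_exp; congr (_ ^+ _).
rewrite horner_sum (eq_bigr (fun=> 1)) ?sumr_const ?card_ord // => i _.
by rewrite horner_exp !hornerE expr1n.
Qed.

(** The element is diag(g,1), which lies in K because 0 < g < p makes g a unit of Z_p. *)
Lemma torus_comb (g N : nat) P : (0 < g)%N -> (g < p)%N -> exists k c, c != 0 /\
  rep_act k (comb N P) = c *: comb N (fun i => P i \Po (('X + 1) ^+ g - 1)).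
Proof.
move=> g0 gp.
have gU : (g%:R : Zp) \is a GRing.unit.
  rewrite unit_residue; apply/negP => /eqP g1; have := residue_nat p_pr g 1.
  by rewrite g1 sub0r rpredN dvdzE /= expn1 gtnNdvd.
have gn0 : (ofZ g%:R) != 0.
  by rewrite tofrac_eq0; apply: contraTneq gU => ->; rewrite unitr0.
pose k := borel_trig 0 gn0 (oner_neq0 _).
have k01 : k 0 1 = 0 by rewrite mxE.
have k00 : k 0 0 = ofZ g%:R by rewrite mxE.
have k11 : k 1 1 = 1 by rewrite mxE.
have kK : KZ k.
  apply: (@KZ_torus _ _ _ (g%:R^-1)); rewrite ?unitrV //.
  by rewrite k00 k11 -rmorphM mulrV // rmorph1.
exists k, (sigma k); split; first exact: sigma_neq0.
rewrite /comb linear_sum scaler_sumr; apply: eq_bigr => i _ /=.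
have kz : k 0 0 / k 1 1 = ofZ g%:R by rewrite k00 k11 divr1.
have zg : exists z' : Zp, (g%:R : Zp) - g%:R = p%:R ^+ N * z'.
  by exists 0; rewrite subrr mulr0.
exact: (torus_pact_e_ eK i (P i) kK k01 kz zg).
Qed.

(** * Stable subspaces *)

Section Submodule.
Variable W : {pred V}.
Hypothesis W_submod : submod_closed W.
Hypothesis W_stable : forall g v, v \in W -> rep_act g v \in W.

Lemma submod_0 : 0 \in W. Proof. by case: W_submod. Qed.
Lemma submod_Z a v : v \in W -> a *: v \in W.
Proof. by case: W_submod => w0 wP vW; rewrite -[_ *: _]addr0; apply: wP. Qed.
Lemma submod_D u v : u \in W -> v \in W -> u + v \in W.
Proof. by case: W_submod => _ wP uW vW; rewrite -[u]scale1r; apply: wP. Qed.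
Lemma submod_B u v : u \in W -> v \in W -> u - v \in W.
Proof. by move=> uW vW; apply: submod_D => //; rewrite -scaleN1r; apply: submod_Z. Qed.
Lemma submod_sum (I : eqType) (r : seq I) (F : I -> V) :
  (forall i, i \in r -> F i \in W) -> \sum_(i <- r) F i \in W.
Proof.
move=> FW; rewrite big_seq; elim/big_rec: _ => [|i v /FW]; first exact: submod_0.
exact: submod_D.
Qed.

Lemma submod_pact x P v : v \in W -> pact (dif x) P v \in W.
Proof.
move=> vW; rewrite pact.unlock; apply: submod_sum => i _; apply: submod_Z.
by elim: (i : nat) => //= j IHj; apply: submod_B => //; apply: W_stable.
Qed.

(** Higher in the tower a level vector is a unit times a translate of X^s e_d. Positive depth makes
    the raised exponent p^a t at most s, so a further power of X leads from the given vector to that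
    one. *)
Lemma pactX_e_in N d t : (d <= N)%N -> (t * (p ^ n).-1 < p ^ (N - d) * m)%N ->
  pact (X N) 'X^t (e_ d) \in W -> exists d', e_ d' \in W.
Proof.
(* Taking N + 1 steps gives a >= n, hence p^a > m, which absorbs the term m in the equation for
   [s]. *)
move=> dN tN tW; have [c [x [s [c0 sE eE]]]] := relX N.+1 d.
have leN : (N + n <= d + N.+1 * n)%N by have := leq_pmulr N n_gt0; lia.
pose a := (d + N.+1 * n - N)%N.
have NaE : (N + a = d + N.+1 * n)%N by rewrite subnKC //; lia.
have na : (n <= a)%N by rewrite /a; lia.
have ts : (p ^ a * t <= s)%N.
  rewrite -(@leq_pmul2r (p ^ n).-1) ?(leq_ltn_trans _ m_lt) //.
  rewrite -(leq_add2r m) sE.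
  have -> : (N.+1 * n = a + (N - d))%N by rewrite /a; lia.
  rewrite expnD -!mulnA; apply: (@leq_trans (p ^ a * (t * (p ^ n).-1) + p ^ a)%N).
    rewrite leq_add2l (leq_trans (ltnW m_lt)) // (leq_trans (leq_pred _)) //.
    by rewrite leq_pexp2l ?prime_gt0.
  by rewrite -mulnSr leq_mul2l tN orbT.
exists (d + N.+1 * n)%N; rewrite eE -NaE -(subnK ts) (exprD 'X) pactM -pactX_raise.
by apply/submod_Z/W_stable/submod_pact.
Qed.

Lemma submod_full d v : e_ d \in W -> v \in W.
Proof.
move=> dW; have [s ->] := e_gen v; apply: submod_sum => c _; apply: submod_Z.
have -> : e = rep_act (diag_p p_pr d)^-1%g (e_ d) by rewrite -rep_actM mulVg rep_act1.
exact/W_stable/W_stable.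
Qed.

(* Applying a torus element multiplies each leading coefficient by a power of [g] that,
   by primitivity, depends on the component. *)
Lemma shrink_support N d al i0 j0 : (n <= N)%N -> (0 < d)%N -> homog N d al ->
  comb N (mono N d al) \in W -> (i0 < n)%N -> (j0 < n)%N -> i0 != j0 ->
  al i0 != 0 -> al j0 != 0 ->
  exists N' d' be, [/\ (n <= N')%N, (0 < d')%N, homog N' d' be &
    [/\ comb N' (mono N' d' be) \in W, forall i, al i = 0 -> be i = 0,
      be i0 = 0 & be j0 != 0]].
Proof.
move=> nN d0 hom cW i0n j0n ij al_i al_j.
have ti := texpP (hom _ i0n al_i); have tj := texpP (hom _ j0n al_j).
set t_i := texp N d i0 in ti; set t_j := texp N d j0 in tj.
have [g [g0 gp gne]] : exists g, [/\ (0 < g)%N, (g < p)%N &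
    (g%:R : E) ^+ t_j != g%:R ^+ t_i].
  have sep i j s t : (i < j)%N -> (j < n)%N ->
      depth N i = (s * (p ^ n).-1 + d)%N -> depth N j = (t * (p ^ n).-1 + d)%N ->
      exists g, [/\ (0 < g)%N, (g < p)%N & (g%:R : E) ^+ s != g%:R ^+ t].
    move=> ltij jn iE jE.
    have [le_t /(natr_exp_neq1 pE)[g [g0 gp gn]]] := primitive_sep p_pr prim mE ltij jn nN iE jE.
    exists g; split=> //; apply: contra_neq gn => gE.
    have gn0 : (g%:R : E) ^+ t != 0 by rewrite expf_neq0 // -(dvdn_pcharf pE) gtnNdvd.
    by apply: (mulIf gn0); rewrite mul1r -exprD subnK.
  move: ij; rewrite neq_ltn => /orP[lt|lt]; last exact: (sep _ _ _ _ lt i0n tj ti).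
  by have [g [g0 gp gn]] := sep _ _ _ _ lt j0n ti tj; exists g; rewrite eq_sym.
have [k [c [c0 kE]]] := torus_comb N (mono N d al) g0 gp.
(* The rescaled torus translate minus g^t_i times the original vector: the leading term of component
   [i0] cancels, while that of [j0] is multiplied by g^t_j - g^t_i, which is nonzero. *)
pose P i := al i *: (((('X + 1) ^+ g - 1) ^+ texp N d i) - (g%:R ^+ t_i) *: 'X^(texp N d i)).
have PE : comb N P = c^-1 *: rep_act k (comb N (mono N d al)) - g%:R ^+ t_i *: comb N (mono N d al).
  rewrite kE scalerA mulVf // scale1r -scaleNr -combZ -combD.
  apply: eq_bigr => i _; congr pact; rewrite /P /mono scalerBr comp_polyZ comp_Xn_poly.
  by rewrite scaleNr !scalerA mulrC.
have PW : comb N P \in W by rewrite PE; apply: submod_B; apply: submod_Z => //; apply: W_stable.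
have Pcoef i t : (t <= texp N d i)%N -> (P i)`_t =
    if t == texp N d i then al i * (g%:R ^+ t - g%:R ^+ t_i) else 0.
  move=> le_t; rewrite /P coefZ coefB coefZ coefXn.
  have [->|ne] := eqVneq; first by rewrite coef_unip_pow_lead mulr1.
  by rewrite coef_unip_pow ltn_neqAle ne le_t mulr0 subr0 mulr0.
have leadE i : lead N d P i =
    if at_depth N d i then al i * (g%:R ^+ texp N d i - g%:R ^+ t_i) else 0.
  by rewrite /lead; case: ifP => // _; rewrite Pcoef // eqxx.
(* The substitution only adds higher powers of X, so no term of [P] has depth above [d]. *)
have [|N' [d' [r [nN' d'0 hom' E']]]] := @homogenize N d P nN d0.
  move=> i t iN Pt.
  have al0 : al i != 0 by apply: contra_neq Pt => a0; rewrite /P a0 scale0r coef0.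
  rewrite (texpP (hom _ iN al0)) leq_add2r leq_mul2r; apply/orP; right.
  rewrite leqNgt; apply: contra_neqN Pt => lt.
  by rewrite Pcoef ?(ltnW lt) // ltn_eqF.
exists N', d', (lead N d P); split=> //; split.
- by rewrite E'; apply: submod_pact.
- by move=> i a0; rewrite leadE a0 mul0r if_same.
- by rewrite leadE subrr mulr0 if_same.
rewrite leadE (hom _ j0n al_j) mulf_neq0 // subr_eq0 //.
Qed.

(** Induction on a bound [c] for the number of nonzero components: [shrink_support] removes one
    while keeping [j], and a single component of positive depth is handled by [pactX_e_in]. *)
Lemma homog_in (c N d : nat) al : (n <= N)%N -> (0 < d)%N -> homog N d al ->
  comb N (mono N d al) \in W -> (\sum_(i < n) (al i != 0)%R <= c)%N ->
  (exists2 j, (j < n)%N & al j != 0) -> exists d', e_ d' \in W.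
Proof.
elim: c N d al => [|c IHc] N d al nN d0 hom cW le_c [j jn alj].
  move: le_c; rewrite leqn0 sum_nat_eq0 => /forallP/(_ (Ordinal jn)) /=.
  by rewrite eqb0 alj.
have [[i [i_n ij ali]]|single] := pselect (exists i, [/\ (i < n)%N, i != j & al i != 0]).
  have [N' [d' [be [nN' d'0 hom' [be_W be0 bei bej]]]]] :=
    shrink_support nN d0 hom cW i_n jn ij ali alj.
  apply: (IHc N' d' be) => //; last by exists j.
  rewrite -ltnS; apply: leq_trans le_c.
  rewrite [Y in (Y < _)%N](bigD1 (Ordinal i_n)) //= [Y in (_ < Y)%N](bigD1 (Ordinal i_n)) //=.
  rewrite bei eqxx ali add0n add1n ltnS; apply: leq_sum => i' _.
  by have [/be0 ->|_] := eqVneq (al i') 0; rewrite ?eqxx ?leq_b1.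
have at_j := hom _ jn alj; have dE := texpP at_j.
apply: (@pactX_e_in N j (texp N d j)).
- exact: leq_trans (ltnW jn) nN.
- by rewrite -/(depth N j) dE -[Y in (Y < _)%N]addn0 ltn_add2l.
have -> : pact (X N) 'X^(texp N d j) (e_ j) = (al j)^-1 *: comb N (mono N d al).
  rewrite /comb (bigD1 (Ordinal jn)) //= big1 ?addr0 => [|i ij].
    by rewrite /mono pactZ scalerA mulVf ?scale1r.
  have [a0|ai] := eqVneq (al i) 0; first by rewrite /mono a0 scale0r pact0.
  by case: single; exists i; split=> //; rewrite -val_eqE in ij.
exact: submod_Z.
Qed.

Lemma stable_submodule_trivial : (forall v, v \in W -> v = 0) \/ (forall v, v \in W).
Proof.
have [[v [vW v0]]|none] := pselect (exists v, v \in W /\ v <> 0); last first.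
  by left=> v vW; apply: contrapT => v0; apply: none; exists v.
right; suff [d dW] : exists d, e_ d \in W by move=> u; apply: (submod_full u dW).
have [D [N [P [nN vE]]]] := comb_span v.
have PW : comb N P \in W by rewrite -vE; apply: W_stable.
have P0 : comb N P != 0.
  apply/eqP => c0; case: v0; apply: (can_inj (g := rep_act (diag_p p_pr D)^-1%g)
     (f := rep_act (diag_p p_pr D))).
    by move=> u; rewrite -rep_actM mulVg rep_act1.
  by rewrite vE c0 linear0.
(* [f i t] is the depth of the monomial X^t e_i of the vector, cut off at 0, and [d] is the maximal
   depth. *)
pose f (i : 'I_n) t := if (P i)`_t != 0 then (depth N i - t * (p ^ n).-1)%N else 0%N.
pose d := (\max_(i < n) \max_(t < size (P i)) f i t)%N.
have f_le (i : 'I_n) t : (f i t <= d)%N.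
  have [lt|le] := ltnP t (size (P i)); last by rewrite /f nth_default ?eqxx.
  by apply: (leq_trans _ (leq_bigmax i)); apply: (leq_bigmax (Ordinal lt)).
have depth_le i t : (i < n)%N -> (P i)`_t != 0 -> (depth N i <= t * (p ^ n).-1 + d)%N.
  move=> iN Pt; have := f_le (Ordinal iN) t.
  by rewrite /f Pt leq_subLR.
(* If [d] were 0, every monomial would vanish by [pactX_e_eq0]: depth exactly 0 cannot occur, as q -
   1 would then divide p^(N-i) m and hence m, while 0 < m < q - 1. *)
have d0 : (0 < d)%N.
  rewrite lt0n; apply: contra_neq P0 => d0; rewrite /comb big1 // => i _.
  rewrite pact_coef big1 // => t _.
  have [->|Pt] := eqVneq (P i)`_t 0; first by rewrite scale0r.
  rewrite pactX_e_eq0 ?scaler0 //; first by rewrite (leq_trans (ltnW _) nN).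
  have := depth_le i t (ltn_ord i) Pt; rewrite d0 addn0 leq_eqVlt => /orP[/eqP E0|//].
  have : ((p ^ n).-1 %| p ^ (N - i) * m)%N by rewrite -/(depth N i) E0 dvdn_mull.
  rewrite Gauss_dvdr ?coprime_pred_exp // => /(dvdn_leq m_gt0).
  by rewrite leqNgt m_lt.
have [i0 di] := @bigop.eq_bigmax 'I_n (fun i => \max_(t < size (P i)) f i t)%N
    (etrans (congr1 _ (card_ord n)) n_gt0).
have szP : (0 < size (P i0))%N.
  rewrite lt0n; apply/eqP => sz; move: d0; rewrite /d di.
  by case: (P i0) sz => -[] //= ? _; rewrite big_ord0.
have [t0 dt] := @bigop.eq_bigmax 'I_(size (P i0)) (fun t => f i0 t)
    (etrans (congr1 _ (card_ord _)) szP).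
have fd : f i0 t0 = d by rewrite /d di dt.
have [N' [d' [r [nN' d'0 hom' E']]]] := homogenize nN d0 depth_le.
apply: (homog_in nN' d'0 hom' _ (leqnn _)); first by rewrite E'; apply: submod_pact.
exists i0 => //; move: fd; rewrite /f; case: ifP => [Pt fd|_ d00]; last by rewrite -d00 in d0.
have dE : depth N i0 = (t0 * (p ^ n).-1 + d)%N.
  rewrite -fd subnKC // ltnW // -subn_gt0 fd //.
have [ati tE] := texp_eq dE.
by rewrite /lead ati tE.
Qed.
End Submodule.
End Tower.

(** * The induced representation *)

Section InducedGenerator.
Local Open Scope classical_set_scope.
Local Open Scope ring_scope.
Variables (p : nat) (p_pr : prime p) (E : fieldType).
Variables (sigma1 sigma2 : smooth_char p_pr E).
Local Notation Zp := (padic_int p_pr).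
Local Notation Qp := (padic p_pr).
Local Notation B := (borel Qp).
Local Notation K := (@borel_K p p_pr).
Local Notation Z := (@borel_Z p p_pr).
Local Notation KZ := (@borel_KZ p p_pr).
Local Notation ofZ := (@padic_of_int p p_pr).
Local Notation sigma := (sigma sigma1 sigma2).
Local Notation I := (ind_rep sigma1 sigma2).
Local Notation br := (bracket sigma1 sigma2).
Local Notation e := (br 1%g : I).

Lemma bracketE g h : br g h = if `[< KZ (h * g)%g >] then sigma (h * g)%g else 0.
Proof.
rewrite /= /bracket_fun; congr (if _ then _ else _); apply/asbool_equiv_eq; split.
  by move=> [k kK <-]; rewrite mulgVK.
by move=> hK; exists (h * g)%g => //; rewrite mulgK.
Qed.

Lemma bracket_act g : br g = rep_act g e.
Proof.
apply: val_inj; apply/funext => h.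
have -> : val (rep_act g e) h = br 1%g (h * g)%g by [].
by rewrite -[LHS]/(br g h) !bracketE mulg1.
Qed.

Lemma bracket_K k : KZ k -> rep_act k e = sigma k *: e.
Proof.
move=> kK; rewrite -bracket_act; apply: val_inj; apply/funext => h.
have -> : val (sigma k *: e) h = sigma k * br 1%g h by [].
rewrite -[LHS]/(br k h) !bracketE mulg1.
case: asboolP => hkK; case: asboolP => hK; rewrite ?mulr0 //.
- by rewrite sigmaM mulrC.
- by case: hK; rewrite -[h](mulgK k); apply: KZ_mul => //; apply: KZ_inv.
- by case: hkK; apply: KZ_mul.
Qed.

(** The entries of h g^-1 tend to those of the identity, 1 + p Z_p consists of units, and Z_p is a
    neighbourhood of 0. *)
Lemma nbhs_K (g : B) : nbhs g [set h | K (h * g^-1)%g].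
Proof.
have gF : Filter (nbhs g) := nbhs_filter g.
have cvg_entry i j : (fun h : B => (h * g^-1)%g i j) @ g --> (1%g : B) i j.
  rewrite -(mulgV g) [X in _ --> X]mx2_mulE; pose g' := g^-1%g.
  change ((fun k : B => (k *m g' : 'M[Qp]_2) i j) @ g -->
    g i 0 * g' 0 j + g i 1 * g' 1 j).
  under [X in X @ _]eq_fun do rewrite mx2_mulE.
  by apply: (@padic_add_cvg _ _ _ (nbhs g) (fun k : B => k i 0 * g' 0 j));
    apply: (@padic_mulr_cvg _ _ _ (nbhs g) (fun k : B => k _ _));
    apply: borel_entry_continuous.
have ball1 (f : B -> Qp) : f @ g --> (1 : Qp) ->
    nbhs g [set h | padic_integral_unit (f h)].
  move=> fg; have : nbhs g (f @^-1` padic_ball 1 1) by apply: fg; exists 1%N.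
  apply: filterS => h [z zE].
  exists (1 + p%:R * z); last first.
    by rewrite rmorphD rmorphM rmorph_nat rmorph1 -[p%:R]expr1 -zE addrC subrK.
  apply: (@padic_unit_closed _ _ _ 1); first exact: unitr1.
  exists (- z); rewrite rmorphD rmorphM rmorph_nat rmorphN /= rmorph1 expr1.
  by rewrite opprD addrA subrr add0r mulrN.
have b0 : nbhs g [set h : B | padic_integral ((h * g^-1)%g 0 1)].
  have : nbhs g ((fun h : B => (h * g^-1)%g 0 1) @^-1` padic_ball 0 0).
    by have := cvg_entry 0 1; rewrite mxE; apply; exists 0%N.
  by apply: filterS => h [z]; rewrite subr0 expr0 mul1r => zE; exists z.
have b1 : nbhs g [set h : B | padic_integral_unit ((h * g^-1)%g 0 0)].
  by apply: ball1; have := cvg_entry 0 0; rewrite mxE.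
have b2 : nbhs g [set h : B | padic_integral_unit ((h * g^-1)%g 1 1)].
  by apply: ball1; have := cvg_entry 1 1; rewrite mxE.
by apply: filterS (filterI b0 (filterI b1 b2)) => h [h0 [h1 h2]].
Qed.

(** Induction on the list of cosets: [g^-1] is supported on KZ g, and subtracting f(g) [g^-1] makes
    [f] vanish there. *)
Lemma bracket_span (f : I) (s : seq B) :
  (forall h, ind_fun f h != 0 -> exists2 g, g \in s & KZ (h * g^-1)%g) ->
  exists t : seq (E * B), f = \sum_(c <- t) c.1 *: rep_act c.2 e.
Proof.
elim: s f => [|g s IHs] f fs.
  exists [::]; rewrite big_nil; apply: val_inj; apply/funext => h.
  by apply: contrapT => /eqP /fs[].
have /asboolP[fK _] := indP f.
pose f' : I := f - (ind_fun f g : E) *: (br g^-1%g : I).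
have f'E h : ind_fun f' h = ind_fun f h - ind_fun f g * br g^-1%g h by [].
have [h|t tE] := IHs f'.
  rewrite f'E bracketE; case: asboolP => [hK|nK].
    by rewrite -{1}[h](mulgVK g) fK // mulrC subrr eqxx.
  rewrite mulr0 subr0 => /fs[g']; rewrite inE => /predU1P[-> //|g's hg'].
  by exists g'.
exists ((ind_fun f g, g^-1%g) :: t); rewrite big_cons -tE -(bracket_act g^-1%g).
by rewrite addrC subrK.
Qed.

Lemma ind_generated (f : I) : exists t : seq (E * B), f = \sum_(c <- t) c.1 *: rep_act c.2 e.
Proof.
have /asboolP[_ [C cC fC]] := indP f.
suff [s sC] : exists s : seq B, forall h, C h -> exists2 g, g \in s & K (h * g^-1)%g.
  apply: (@bracket_span f s) => h /fC[z zZ [c cC' <-]].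
  have [g gs kg] := sC c cC'; exists g => //.
  exists (c * g^-1)%g => //; exists z => //.
  by rewrite -(zZ (c * g^-1)%g) mulgA.
(* The finite subcover of [C] by open cosets Kg comes from the filter formulation of compactness,
   applied to the filter of lists containing a given finite list. *)
pose F : set_system (seq B) :=
  [set A | exists s : seq B, forall s' : seq B, {subset s <= s'} -> A s'].
have FF : Filter F.
  split; first by exists [::].
    move=> A A' [s sA] [s' sA']; exists (s ++ s') => s2 ss2.
    by split; [apply: sA|apply: sA'] => x xs; apply: ss2; rewrite mem_cat xs ?orbT.
  by move=> A A' AA' [s sA]; exists s => s' /sA /AA'.
have /compact_near_coveringP nC := cC.
have [|s sC] := nC (seq B) F (fun s h => exists2 g, g \in s & K (h * g^-1)%g) FF.
  move=> g _; exists ([set h | K (h * g^-1)%g], [set s : seq B | (g : B) \in s]) => /=.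
    by split; [apply: nbhs_K|exists [:: g] => s' /(_ g (mem_head _ _))].
  by move=> [h s] [/= hK gs]; exists g.
by exists s => h /(sC s (fun x xs => xs)).
Qed.
End InducedGenerator.

(** * The generator of the relations *)

(** In k C(q,k) = q C(q-1,k-1), a binomial coefficient prime to p would force q to divide k. *)
Lemma dvdn_bin_pexp p n k : prime p -> (0 < k)%N -> (k < p ^ n)%N -> (p %| 'C(p ^ n, k))%N.
Proof.
move=> p_pr; case: k => // k _ kq; apply: contraLR kq => npC; rewrite -leqNgt.
have cop : coprime (p ^ n) 'C(p ^ n, k.+1) by rewrite coprimeXl // prime_coprime.
apply: dvdn_leq => //; rewrite -(Gauss_dvdl _ cop) -mul_bin_diag.
exact: dvdn_mulr.
Qed.

(** Summation by parts; the differences of binomial coefficients then simplify by Pascal's rule. *)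
Lemma abel_sum (R : comNzRingType) (a : nat -> R) (y : R) N :
  (y - 1) * \sum_(j < N) a j * y ^+ (N - j) =
  a 0 * y ^+ N.+1 + \sum_(j < N) (a j.+1 - a j) * y ^+ (N - j) - a N * y.
Proof.
elim: N => [|N IHN]; first by rewrite !big_ord0 expr1; ring.
have shift (b : nat -> R) :
    \sum_(j < N.+1) b j * y ^+ (N.+1 - j) = y * (\sum_(j < N) b j * y ^+ (N - j)) + b N * y.
  rewrite big_ord_recr /= subSnn expr1 mulr_sumr; congr (_ + _).
  by apply: eq_bigr => j _; rewrite subSn ?(ltnW (ltn_ord j)) // exprS mulrCA.
rewrite (shift a) (shift (fun j => a j.+1 - a j)) mulrDr mulrCA IHN (exprS y N.+1).
by move: (\sum_(j < N) _) => D; ring.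
Qed.

(** Let S_k be the sum for l = k. Summation by parts gives X S_(k+1) = S_k, the boundary terms
    vanishing since p divides C(q,k+1), and X S_0 = (X + 1) X^q. *)
Lemma sum_binom_pow (p : nat) (E : fieldType) n l : p \in [pchar E] -> (l < p ^ n)%N ->
  \sum_(j < p ^ n) 'C(j, l)%:R *: ('X + 1 : {poly E}) ^+ (p ^ n - j) =
  ('X + 1) * 'X^((p ^ n).-1 - l).
Proof.
move=> pE lq; have p_pr := pcharf_prime pE.
have q0 : (0 < p ^ n)%N by rewrite expn_gt0 prime_gt0.
have pP : p \in [pchar {poly E}] by rewrite pchar_poly.
have XE : 'X + 1 - 1 = 'X :> {poly E} by rewrite addrK.
pose S (l : nat) : {poly E} := \sum_(j < p ^ n) ('C(j, l)%:R : {poly E}) * ('X + 1) ^+ (p ^ n - j).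
have SE k : 'X * S k = 'C(0, k)%:R * ('X + 1) ^+ (p ^ n).+1 +
   \sum_(j < p ^ n) ('C(j.+1, k)%:R - 'C(j, k)%:R) * ('X + 1) ^+ (p ^ n - j)
   - 'C(p ^ n, k)%:R * ('X + 1).
  by rewrite -[in LHS]XE (abel_sum (fun j => 'C(j, k)%:R)).
suff SX (k : nat) : (k < p ^ n)%N -> 'X^(k.+1) * S k = ('X + 1) * 'X^(p ^ n).
  have Xl0 : 'X^(l.+1) != 0 :> {poly E} by rewrite -size_poly_eq0 size_polyXn.
  apply: (mulfI Xl0); rewrite mulrCA -exprD.
  have -> : (l.+1 + ((p ^ n).-1 - l) = p ^ n)%N by lia.
  rewrite -(SX l lq) /S; congr (_ * _); apply: eq_bigr => j _.
  by rewrite scaler_nat mulr_natl.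
elim: k => [|k IHk] kq.
  rewrite expr1 SE bin0 big1 ?addr0 => [|j _]; last by rewrite !bin0 subrr mul0r.
  have <- : ('X + 1 : {poly E}) ^+ (p ^ n) - 1 = 'X^(p ^ n).
    by rewrite (exprDpX pP) expr1n addrK.
  by rewrite bin0 !mul1r exprS mulrBr mulr1.
rewrite exprSr -mulrA SE bin0n mul0r add0r.
have -> : 'C(p ^ n, k.+1)%:R = 0 :> {poly E}.
  by apply/eqP; rewrite -(dvdn_pcharf pP) dvdn_bin_pexp.
rewrite mul0r subr0 -IHk ?(ltnW kq) //; congr (_ * _); apply: eq_bigr => j _.
by rewrite binS natrD addrC addKr.
Qed.

Section Generator.
Variables (p : nat) (p_pr : prime p) (E : fieldType).
Variables (sigma1 sigma2 : smooth_char p_pr E).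
Hypothesis pE : p \in [pchar E].
Local Notation Zp := (padic_int p_pr).
Local Notation Qp := (padic p_pr).
Local Notation B := (borel Qp).
Local Notation KZ := (@borel_KZ p p_pr).
Local Notation ofZ := (@padic_of_int p p_pr).
Local Notation sigma := (sigma sigma1 sigma2).
Local Notation I := (ind_rep sigma1 sigma2).
Local Notation e := (bracket sigma1 sigma2 1%g : I).
Local Notation e_ := (level_vec e).
Local Notation X N := (dif (V := I) (p%:R ^- N)).

Lemma e_0 : e_ 0 = e.
Proof.
rewrite /level_vec; have -> : diag_p p_pr 0 = 1%g by apply: borelE; rewrite !mxE.
exact: rep_act1.
Qed.

(** Since u(1) fixes the vector, -j p^-n may be replaced by the natural multiple (q - j) p^-n, which
    turns the sum into that of [sum_binom_pow]. *)
Lemma w_eltE n l : (l < p ^ n)%N ->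
  w_elt sigma1 sigma2 l n =
  rep_act (unip (p%:R ^- n)) (pact (X n) 'X^((p ^ n).-1 - l) (e_ 0)).
Proof.
move=> lq; rewrite /w_elt big_mkord.
rewrite -[p%:R ^- n]mulr1n unip_pact mulr1n expr1 -pactM -sum_binom_pow // pact_sum.
apply: eq_bigr => j _; rewrite pactZ; congr (_ *: _).
rewrite -unip_pact; transitivity (rep_act (unip (- (j%:R * p%:R ^- n))) (e_ 0)).
  by rewrite e_0 bracket_act.
have -> : p%:R ^- n *+ (p ^ n - j) = - (j%:R * p%:R ^- n) + 1 :> Qp.
  rewrite mulrnBr ?(ltnW (ltn_ord j)) // addrC -[_ *+ (p ^ n)]mulr_natl natrX.
  by rewrite mulfV ?pX_neq0 // -[_ *+ j]mulr_natl addrC.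
rewrite rep_unipD (unip_e_ (@bracket_K p p_pr E sigma1 sigma2) (x := 1) (z := 1)) //.
by rewrite expr0 mul1r rmorph1.
Qed.

Lemma S_generatorE n h : (h * p.-1 < p ^ n)%N ->
  S_generator sigma1 sigma2 n h = (- (sigma1 p%:R)^-1) ^+ n *: e_ n +
  rep_act (unip (p%:R ^- n)) (pact (X n) 'X^((p ^ n).-1 - h * p.-1) (e_ 0)).
Proof. by move=> hq; rewrite /S_generator w_eltE // bracket_act. Qed.
End Generator.

(** * The grading of the induced representation *)

Section KZEntries.
Variables (p : nat) (p_pr : prime p).
Local Notation Zp := (padic_int p_pr).
Local Notation Qp := (padic p_pr).
Local Notation B := (borel Qp).
Local Notation KZ := (@borel_KZ p p_pr).
Local Notation ofZ := (@padic_of_int p p_pr).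

Lemma padic_p_nunit : ((p%:R : Zp) \is a GRing.unit) = false.
Proof. by rewrite unit_residue -[p%:R]mulr1 -[p%:R]expr1 residue_Xmul eqxx. Qed.

(** A central element is scalar: commuting with u(1) equates its diagonal entries, and commuting
    with diag(1,p) kills its corner. *)
Lemma KZ_entries (k : B) : KZ k -> exists y b : Zp,
  [/\ y \is a GRing.unit, k 0 0 = ofZ y * k 1 1 & k 0 1 = ofZ b * k 1 1].
Proof.
move=> [k0 [[a aU k00] [d dU k11] [b _ k01]] [z zZ kE]].
have e00 : k 0 0 = k0 0 0 * z 0 0 by rewrite -kE borel_mulE00.
have e11 : k 1 1 = k0 1 1 * z 1 1 by rewrite -kE borel_mulE11.
have e01 : k 0 1 = k0 0 0 * z 0 1 + k0 0 1 * z 1 1 by rewrite -kE borel_mulE01.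
have /(congr1 (fun g : B => g 0 1)) := zZ (unip 1).
rewrite !borel_mulE01 !mxE /= mulr1 mul1r mulr1 mul1r addrC => /addrI zE.
have /(congr1 (fun g : B => g 0 1)) := zZ (diag_p p_pr 1).
rewrite !borel_mulE01 !mxE /= mulr0 mul0r mul1r add0r addr0 expr1 => z01E.
have z01 : z 0 1 = 0.
  apply/eqP; apply: contraFT padic_p_nunit => z01.
  suff -> : (p%:R : Zp) = 1 by exact: unitr1.
  apply: (@padic_of_int_inj p p_pr); rewrite padic_of_int_nat rmorph1.
  by apply: (mulfI z01); rewrite mulr1.
exists (a / d), (b / d); split; first by rewrite unitrM aU unitrV.
- by rewrite e00 e11 -k00 -k11 zE mulrA -padic_intM divrK.
- by rewrite e01 e11 -k11 -k01 z01 mulr0 add0r mulrA -padic_intM divrK.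
Qed.

Lemma unit_pow_inj (y y' : Zp) i j : y \is a GRing.unit -> y' \is a GRing.unit ->
  ofZ y * p%:R ^+ i = ofZ y' * p%:R ^+ j -> i = j.
Proof.
suff le (u u' : Zp) a b : u \is a GRing.unit ->
    ofZ u * p%:R ^+ a = ofZ u' * p%:R ^+ b -> (b <= a)%N.
  by move=> yU y'U E; apply/eqP; rewrite eqn_leq (le y' y j i) // (le y y' i j).
move=> uU E; rewrite leqNgt; apply: contraFN padic_p_nunit => ab.
have uE : u = p%:R * (p%:R ^+ (b - a).-1 * u').
  apply: (@padic_of_int_inj p p_pr); apply: (mulIf (pX_neq0 p_pr a)).
  rewrite E mulrA -exprS prednK ?subn_gt0 // rmorphM rmorphXn rmorph_nat /=.
  by rewrite mulrAC -exprD subnK ?(ltnW ab) // mulrC.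
by move: uU; rewrite uE unitrM => /andP[].
Qed.
End KZEntries.

Section InducedBasis.
Variables (p : nat) (p_pr : prime p) (E : fieldType).
Variables (sigma1 sigma2 : smooth_char p_pr E).
Hypothesis pE : p \in [pchar E].
Local Notation Zp := (padic_int p_pr).
Local Notation Qp := (padic p_pr).
Local Notation B := (borel Qp).
Local Notation KZ := (@borel_KZ p p_pr).
Local Notation ofZ := (@padic_of_int p p_pr).
Local Notation sigma := (sigma sigma1 sigma2).
Local Notation I := (ind_rep sigma1 sigma2).
Local Notation e := (bracket sigma1 sigma2 1%g : I).
Local Notation e_ := (level_vec e).
Local Notation X N := (dif (V := I) (p%:R ^- N)).

Definition ev (h : B) (f : I) : E^o := ind_fun f h.

Lemma ev_is_linear h : linear (ev h). Proof. by []. Qed.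
HB.instance Definition _ h := GRing.isLinear.Build E I E^o *:%R (ev h) (ev_is_linear h).

Lemma ev_sum (J : finType) h (F : J -> I) : ev h (\sum_j F j) = \sum_j ev h (F j).
Proof. exact: (linear_sum (ev h)). Qed.

Lemma ev_act h g f : ev h (rep_act g f) = ev (h * g)%g f. Proof. by []. Qed.

Lemma ev_e h : ev h e = if `[< KZ h >] then sigma h else 0.
Proof. by rewrite /ev bracketE mulg1. Qed.

(** The graded piece of degree [d]: the ratio of the diagonal entries has valuation [d] on the
    support. Unipotents preserve this ratio. *)
Definition in_layer d (f : I) := forall h, ev h f != 0 ->
  exists2 y : Zp, y \is a GRing.unit & h 0 0 = ofZ y * p%:R ^+ d * h 1 1.

Lemma layer_lin d a f f' : in_layer d f -> in_layer d f' -> in_layer d (a *: f + f').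
Proof.
move=> fd f'd h; rewrite linearP /=; have [->|/fd //] := eqVneq (ev h f) 0.
by rewrite scaler0 add0r => /f'd.
Qed.

Lemma layer0 d : in_layer d 0.
Proof. by move=> h; rewrite linear0 eqxx. Qed.

Lemma layer_unip d x f : in_layer d f -> in_layer d (rep_act (unip x) f).
Proof.
move=> fd h; rewrite ev_act => /fd[y yU]; rewrite borel_mulE00 borel_mulE11 !mxE /= !mulr1 => hE.
by exists y.
Qed.

Lemma layer_pact d x P f : in_layer d f -> in_layer d (pact (dif x) P f).
Proof.
move=> fd; rewrite pact.unlock; elim/big_rec: _ => [|i g _ gd]; first exact: layer0.
apply: layer_lin => //; elim: (i : nat) => //= j jd.
by rewrite /dif addrC -scaleN1r; apply: layer_lin => //; apply: layer_unip.
Qed.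

Lemma layer_e d : in_layer d (e_ d).
Proof.
move=> h; rewrite /level_vec ev_act ev_e; case: asboolP => [/KZ_entries[y [_ [yU hE _]]] _|_].
  exists y => //; move: hE; rewrite borel_mulE00 borel_mulE11 !mxE /= mulr1 => ->.
  by rewrite -mulrA [h 1 1 * _]mulrC mulrA.
by rewrite eqxx.
Qed.

(** Different layers have disjoint supports, so the sum evaluated at a point of the support of one
    term is that term. *)
Lemma layer_free M N (P : nat -> {poly E}) :
  \sum_(d < M) pact (X N) (P d) (e_ d) = 0 ->
  forall d, (d < M)%N -> pact (X N) (P d) (e_ d) = 0.
Proof.
move=> sum0 d dM; apply: val_inj; apply/funext => h; apply/eqP.
rewrite -[_ == _]/(ev h (pact (X N) (P d) (e_ d)) == 0).
apply: contraTT isT => evd; move: (congr1 (ev h) sum0).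
rewrite linear_sum linear0 (bigD1 (Ordinal dM)) //= big1 ?addr0 => [/eqP|i id].
  by rewrite (negPf evd).
apply/eqP; apply: contraNT id => evi.
have [y yU hE] := layer_pact (@layer_e d) evd.
have [y' y'U] := layer_pact (@layer_e i) evi.
have /andP[_ h1] := borel_diag h.
by rewrite hE => /(mulIf h1)/(unit_pow_inj yU y'U) di; rewrite -val_eqE /= di.
Qed.

(** X^(p^a - 1) is the sum of (1 + X)^j over j < p^a. It turns e_d into a sum of translates, of
    which only j = 0 is nonzero at the chosen point. *)
Lemma ev_norm d a :
  ev (diag_p p_pr d)^-1%g (pact (X (d + a)) 'X^((p ^ a).-1) (e_ d)) = 1.
Proof.
have pP : p \in [pchar {poly E}] by rewrite pchar_poly.
have q0 : (0 < p ^ a)%N by rewrite expn_gt0 prime_gt0.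
have -> : 'X^((p ^ a).-1) = \sum_(j < p ^ a) ('X + 1) ^+ j :> {poly E}.
  have X0 : 'X != 0 :> {poly E} by rewrite polyX_eq0.
  apply: (mulfI X0); rewrite -exprS prednK //.
  by have := subrX1 ('X + 1 : {poly E}) (p ^ a); rewrite addrK (exprDpX pP) expr1n addrK.
rewrite pact_sum ev_sum (bigD1 (Ordinal q0)) // big1 ?addr0 => [|j j0].
  rewrite [nat_of_ord _]/= expr0 pact1 /level_vec ev_act mulVg ev_e.
  case: asboolP => [_|[]]; first by rewrite -unip0 sigma_unip; exact: addr0.
  by rewrite -unip0 -(rmorph0 (@padic_of_int p p_pr)); apply: KZ_unip.
rewrite -unip_pact /level_vec !ev_act -mulgA.
have -> : p%:R ^- (d + a) *+ j = (j%:R * p%:R ^- a) * p%:R ^- d :> Qp.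
  by rewrite -[LHS]mulr_natl exprD invfM mulrA mulrAC.
rewrite -diag_p_unip mulKg ev_e; case: asboolP => // /KZ_entries[_ [b [_ _]]].
rewrite !mxE /= mulr1 => jE; case/eqP: j0; apply: val_inj => /=.
have jb : j%:R = p%:R ^+ a * b :> Zp.
  apply: (@padic_of_int_inj p p_pr); rewrite rmorphM rmorphXn !rmorph_nat /= -jE.
  by rewrite mulrCA mulfV ?mulr1 // pX_neq0.
have := residue_nat p_pr j a; rewrite jb residue_Xmul sub0r rpredN dvdzE /= => dv.
apply/eqP; rewrite -leqn0 leqNgt; apply: contraL dv => j0.
by rewrite gtnNdvd // ltn_ord.
Qed.

(** If t is the least exponent with a nonzero coefficient, multiplying by X^(p^(N-d) - 1 - t) leaves
    only a multiple of the vector of [ev_norm], which is nonzero. *)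
Lemma e_annihilator N d Q t : (d <= N)%N -> pact (X N) Q (e_ d) = 0 ->
  (t < p ^ (N - d))%N -> Q`_t = 0.
Proof.
move=> dN Q0; elim/ltn_ind: t => t IHt tq.
have eK := @bracket_K p p_pr E sigma1 sigma2.
pose s := ((p ^ (N - d)).-1 - t)%N.
have st : (s + t = (p ^ (N - d)).-1)%N by rewrite /s; lia.
have : pact (X N) 'X^s (pact (X N) Q (e_ d)) =
    Q`_t *: pact (X N) 'X^(s + t) (e_ d).
  have [szQ|szQ] := ltnP t (size Q); last first.
    rewrite nth_default // scale0r (pact_coef _ Q) big1 ?linear0 // => i _.
    have it : (i < t)%N by apply: leq_trans szQ.
    by rewrite IHt ?scale0r // (ltn_trans it).
  rewrite (pact_coef _ Q) linear_sum (bigD1 (Ordinal szQ)) //= big1 ?addr0 => [|i it].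
    by rewrite linearZ /= exprD pactM.
  rewrite linearZ /= -pactM -exprD.
  move: it; rewrite -val_eqE neq_ltn => /orP[lt|lt] /=.
    by rewrite IHt ?scale0r // (ltn_trans lt).
  rewrite (difX_e_ eK pE) ?scaler0 // -[(p ^ _)%N]prednK ?(leq_ltn_trans _ tq) //.
  by rewrite -st -addnS leq_add2l.
rewrite Q0 linear0 st => /esym /(congr1 (ev (diag_p p_pr d)^-1%g)).
rewrite linear0 linearZ /=; have := ev_norm d (N - d); rewrite subnKC // => ->.
by rewrite [_ *: _]mulr1.
Qed.
End InducedBasis.

(** * The relations do not generate everything *)

Section NonZero.
Variables (p : nat) (p_pr : prime p) (E : fieldType).
Variables (sigma1 sigma2 : smooth_char p_pr E).
Hypothesis pE : p \in [pchar E].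
Local Notation Zp := (padic_int p_pr).
Local Notation Qp := (padic p_pr).
Local Notation B := (borel Qp).
Local Notation KZ := (@borel_KZ p p_pr).
Local Notation ofZ := (@padic_of_int p p_pr).
Local Notation sigma := (sigma sigma1 sigma2).
Local Notation I := (ind_rep sigma1 sigma2).
Local Notation e := (bracket sigma1 sigma2 1%g : I).
Local Notation e_ := (level_vec e).
Local Notation X N := (dif (V := I) (p%:R ^- N)).
Local Notation eK := (@bracket_K p p_pr E sigma1 sigma2).

Variables (n m : nat) (c : E).
Hypothesis n_gt0 : (0 < n)%N.
Hypothesis m_gt0 : (0 < m)%N.
Hypothesis m_lt : (m < p ^ n)%N.
Hypothesis m_dvd : (p.-1 %| m)%N.

Definition rel_elt : I := c *: e_ n + rep_act (unip (p%:R ^- n)) (pact (X n) 'X^m (e_ 0)).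
Definition rel_ d : I := rep_act (diag_p p_pr d) rel_elt.

Lemma rel_eltE : rel_elt = c *: e_ n + pact (X n) (('X + 1) * 'X^m) (e_ 0).
Proof. by rewrite /rel_elt -[p%:R ^- n]mulr1n unip_pact expr1 mulr1n pactM. Qed.

Lemma rel_E d : rel_ d = c *: e_ (d + n) + pact (X (d + n)) (('X + 1) * 'X^m) (e_ d).
Proof.
by rewrite /rel_ rel_eltE rep_actD rep_actZ diag_pact !diag_e_ addn0.
Qed.

(** Torus translates of the relation stay in its E[X]-span, so only diag(1,p^d) and polynomials in X
    remain to be considered. As p - 1 divides m, g^m = 1, which matches the scalars on the two parts
    of the relation. *)
Lemma torus_rel (k : B) (y : Zp) : y \is a GRing.unit -> k 0 1 = 0 ->
  k 1 1 = k 0 0 * ofZ y -> exists R, rep_act k rel_elt = sigma k *: pact (X n) R rel_elt.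
Proof.
move=> yU k01 k11; have kK := KZ_torus yU k01 k11.
have [k0 k1] := andP (borel_diag k).
have kz : k 0 0 / k 1 1 = ofZ y^-1.
  apply: (mulIf k1); rewrite divfK // k11 mulrC -mulrA.
  by rewrite padic_int_mulV // mulr1.
have [g [z' gE]] := padic_residue_nat y^-1 n.
have g0 : (g%:R : E) != 0.
  rewrite -(dvdn_pcharf pE); apply/negP => /dvdnP[g' g'E].
  have : y^-1 \is a GRing.unit by rewrite unitrV.
  have -> : y^-1 = p%:R * (p%:R ^+ n.-1 * z' + g'%:R).
    rewrite -[LHS](subrK g%:R) gE g'E natrM mulrDr mulrA -exprS prednK //.
    by rewrite [_%:R * p%:R]mulrC.
  by rewrite unitrM padic_p_nunit.
pose S : {poly E} := \sum_(i < g) ('X + 1) ^+ i.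
pose A := ('X + 1) ^+ g * S ^+ m.
(* The factor (1 + X)^(q-1) inverts 1 + X modulo X^q, which kills e_0. So [R] takes (1 + X) X^m to A
   X^m, its image under the substitution, and its constant term 1 fixes e_n. *)
pose R := A * ('X + 1) ^+ (p ^ n).-1.
have q0 : (0 < p ^ n)%N by rewrite expn_gt0 prime_gt0.
have gm : (g%:R : E) ^+ m = 1.
  by rewrite -(divnK m_dvd) mulnC exprM natr_fermat // expr1n.
have R0 : R`_0 = 1.
  rewrite -horner_coef0 /R /A !hornerM !horner_exp !hornerE horner_sum.
  rewrite (eq_bigr (fun=> 1)) => [|i _]; last by rewrite horner_exp !hornerE expr1n.
  by rewrite sumr_const card_ord !expr1n gm !mulr1.
have pP : p \in [pchar {poly E}] by rewrite pchar_poly.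
have RE : R * (('X + 1) * 'X^m) = A * 'X^m + A * 'X^(p ^ n + m).
  rewrite /R -mulrA [_ ^+ _ * (_ * _)]mulrA -exprSr prednK // (exprDpX pP) expr1n.
  by rewrite mulrDl mul1r -exprD mulrDr addrC.
exists R; rewrite rel_eltE rep_actD rep_actZ (torus_e_ eK) //.
rewrite (torus_pact_e_ eK 0 _ kK k01 kz (ex_intro _ z' gE)).
rewrite pactDr pactZr (pact_ker _ (dif_e_ eK n)) R0 scale1r -pactM RE pactD.
rewrite (pactM _ A 'X^(_ + _)) (difX_e_ eK pE) ?subn0 ?leq_addr // linear0 addr0.
rewrite scalerDr !scalerA mulrC; congr (_ + _ *: pact _ _ _).
rewrite comp_polyM comp_polyD comp_polyX comp_polyC comp_Xn_poly subrK.
by rewrite subrX1 addrK exprMn mulrCA mulrC -!mulrA.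
Qed.
Lemma rel_unip d x N (z : Zp) : p%:R ^+ N * x = ofZ z -> exists j,
  rep_act (unip x) (rel_ d) = pact (X N) (('X + 1) ^+ j) (rel_ d).
Proof.
move=> /padic_frac[j [z' ->]]; exists j.
rewrite -unip_pact rep_unipD rel_E [rep_act _ (_ + _)]rep_actD rep_actZ unip_pactC.
by rewrite !(unip_integral_e_ eK).
Qed.

(** The vanishing of [Q] beyond [M] allows [sum_rel] to extend its sum to a longer range. *)
Definition rel_span D M N (f : I) := exists Q : nat -> {poly E},
  (forall d, (M <= d)%N -> Q d = 0) /\
  rep_act (diag_p p_pr D) f = \sum_(d < M) pact (X N) (Q d) (rel_ d).

Lemma rel_span_translate (g : B) : exists D0, forall D, (D0 <= D)%N ->
  exists M0, forall M, (M0 <= M)%N -> exists N0, forall N, (N0 <= N)%N ->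
  rel_span D M N (rep_act g rel_elt).
Proof.
have [D0 HD] := borel_decomp g; exists D0 => D /HD[x [d [k [y [yU k01 k11 gE]]]]].
exists d.+1 => M dM; have [N1 [z xz]] := padic_denom x.
exists (d + n + N1)%N => N leN.
have [R kE] := torus_rel yU k01 k11.
have [j jE] : exists j, rep_act (unip x) (rel_ d) = pact (X N) (('X + 1) ^+ j) (rel_ d).
  apply: (@rel_unip _ _ _ (p%:R ^+ (N - N1) * z)).
  rewrite rmorphM rmorphXn rmorph_nat /= -xz mulrA -exprD subnK //.
  exact: leq_trans (leq_addl _ _) leN.
pose P := sigma k *: ((R \Po 'X^(p ^ (N - (d + n)))) * ('X + 1) ^+ j).
exists (fun i => if i == d then P else 0); split.
  by move=> i Mi; rewrite gtn_eqF // (leq_trans dM).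
rewrite (bigD1 (Ordinal dM)) // eqxx big1 ?addr0 => [|i ne]; last first.
  by rewrite -val_eqE in ne; rewrite (negPf ne) pact0.
rewrite -rep_actM gE !rep_actM kE !rep_actZ diag_pact unip_pactC -/(rel_ d) jE.
rewrite [RHS]addr0 pactZ pactM; congr (_ *: _).
rewrite (pact_raise pE _ (N - (d + n))) subnKC //.
exact: leq_trans (leq_addr _ _) leN.
Qed.

Lemma rel_span_lin D M N a f f' : rel_span D M N f -> rel_span D M N f' ->
  rel_span D M N (a *: f + f').
Proof.
move=> [Q [Q0 QE]] [Q' [Q'0 Q'E]]; exists (fun d => a *: Q d + Q' d); split.
  by move=> d Md; rewrite Q0 // Q'0 // scaler0 addr0.
rewrite rep_actP QE Q'E scaler_sumr -big_split; apply: eq_bigr => d _.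
by rewrite pactD pactZ.
Qed.

Lemma rel_span_translates f : f \in translates_span rel_elt -> exists D0, forall D, (D0 <= D)%N ->
  exists M0, forall M, (M0 <= M)%N -> exists N0, forall N, (N0 <= N)%N -> rel_span D M N f.
Proof.
move=> /asboolP[s ->]; elim: s => [|[a g] s [D1 IH]].
  exists 0%N => D _; exists 0%N => M _; exists 0%N => N _; exists (fun=> 0); split=> //.
  by rewrite big_nil rep_act0 big1 // => d _; rewrite pact0.
have [D2 HD2] := rel_span_translate g.
exists (D1 + D2)%N => D leD.
have [M1 {}IH] := IH D (leq_trans (leq_addr _ _) leD).
have [M2 HM2] := HD2 D (leq_trans (leq_addl _ _) leD).
exists (M1 + M2)%N => M leM.
have [N1 {}IH] := IH M (leq_trans (leq_addr _ _) leM).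
have [N2 HN2] := HM2 M (leq_trans (leq_addl _ _) leM).
exists (N1 + N2)%N => N leN; rewrite big_cons; apply: rel_span_lin.
  exact: HN2 (leq_trans (leq_addl _ _) leN).
exact: IH (leq_trans (leq_addr _ _) leN).
Qed.

(** The relation of index d has a bottom part in degree d and a top part in degree d + n; the right
    side collects terms by degree. *)
Lemma sum_rel M N (Q : nat -> {poly E}) : (M + n <= N)%N -> (forall d, (M <= d)%N -> Q d = 0) ->
  \sum_(d < M) pact (X N) (Q d) (rel_ d) =
  \sum_(d < n + M) pact (X N) ((if (n <= d)%N then c *: Q (d - n)%N else 0) +
    Q d * (('X + 1) * 'X^m \Po 'X^(p ^ (N - (d + n))))) (e_ d).
Proof.
move=> leN Q0.
have shiftE (F : nat -> I) : (forall d, (d < n)%N -> F d = 0) ->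
    \sum_(d < n + M) F d = \sum_(d < M) F (n + d)%N.
  by move=> F0; rewrite big_split_ord /= big1 ?add0r // => d _; apply: F0 => /=.
have truncE (F : nat -> I) : (forall d, (M <= d)%N -> F d = 0) ->
    \sum_(d < n + M) F d = \sum_(d < M) F d.
  move=> F0; rewrite addnC big_split_ord /= [Y in _ + Y]big1 ?addr0 // => d _.
  by apply: F0; rewrite leq_addr.
under [RHS]eq_bigr do rewrite pactD.
rewrite big_split.
rewrite (shiftE (fun d =>
  pact (X N) (if (n <= d)%N then c *: Q (d - n)%N else 0) (e_ d))); last first.
  by move=> d dn; rewrite leqNgt dn pact0.
rewrite (truncE (fun d => pact (X N) (Q d *
    (('X + 1) * 'X^m \Po 'X^(p ^ (N - (d + n))))) (e_ d))); last first.
  by move=> d Md; rewrite Q0 // mul0r pact0.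
rewrite -big_split; apply: eq_bigr => d _.
rewrite leq_addr addKn pactZ pactM rel_E pactDr pactZr [(n + d)%N]addnC; congr (_ + pact _ _ _).
rewrite (pact_raise pE _ (N - (d + n))) subnKC //.
by rewrite (leq_trans _ leN) // leq_add2r ltnW.
Qed.

Lemma e_notin_translates : e \notin translates_span rel_elt.
Proof.
apply/negP => /rel_span_translates[D /(_ D (leqnn _))[M0 HM]].
(* The summand [D.+1] ensures that degree [D] occurs in the sum. *)
pose M := (M0 + D.+1)%N.
have [N0 HN] := HM M (leq_addr _ _).
pose N := (N0 + (M + n))%N.
have [Q [Q0]] := HN N (leq_addr _ _).
have leN : (M + n <= N)%N by rewrite leq_addl.
have DM : (D < n + M)%N by rewrite ltn_addl // leq_addl.
pose G d : {poly E} := ('X + 1) * 'X^m \Po 'X^(p ^ (N - (d + n))).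
pose R d := (if (n <= d)%N then c *: Q (d - n)%N else 0) + Q d * G d.
move=> QE.
have eE : e_ D = \sum_(d < n + M) pact (X N) (R d) (e_ d) := etrans QE (sum_rel leN Q0).
have R0 d t : (d < n + M)%N -> (t < p ^ (N - d))%N ->
    (R d - (if d == D then 1 else 0))`_t = 0.
  move=> dM tN; apply: (@e_annihilator _ _ _ sigma1 sigma2 pE N d _ t) => //.
    by rewrite (leq_trans (ltnW dM)) // addnC.
  move: d dM {t tN}; apply: layer_free.
  transitivity (\sum_(d < n + M) pact (X N) (R d) (e_ d) -
      \sum_(d < n + M) pact (X N) (if (d : nat) == D then 1 else 0) (e_ d)).
    by rewrite -sumrB; apply: eq_bigr => d _; rewrite pactD pactN.
  rewrite -eE; apply/eqP; rewrite subr_eq0; apply/eqP.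
  rewrite (bigD1 (Ordinal DM)) // big1 => [|i iD].
    by rewrite eqxx pact1; exact: esym (addr0 _).
  by rewrite -val_eqE in iD; rewrite (negPf iD) pact0.
have pgt0 i : (0 < p ^ i)%N by rewrite expn_gt0 prime_gt0.
have GE d : G d = ('X^(p ^ (N - (d + n))) + 1) * 'X^(p ^ (N - (d + n)) * m).
  by rewrite /G comp_polyM comp_polyD comp_polyX comp_polyC comp_Xn_poly -exprM.
(* With a = p^(N-d-n), the coefficient of R_d at t + am is that of Q_d at t, plus one of c Q_(d-n)
   which vanishes by induction because t + am < p^(N-d). *)
have Qlow d : (d < D)%N -> forall t, (t < p ^ (N - (d + n)))%N -> (Q d)`_t = 0.
  elim/ltn_ind: d => d IHd dD t tq.
  pose a := (p ^ (N - (d + n)))%N.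
  have aq : (p ^ (N - d) = a * p ^ n)%N by rewrite -expnD; congr expn; lia.
  have low_lt : (t + a * m < a * p ^ n)%N.
    apply: (@leq_trans (a * m.+1)); first by rewrite mulnS ltn_add2r.
    by rewrite leq_mul2l m_lt orbT.
  have := @R0 d (t + a * m)%N (ltn_trans dD DM).
  rewrite ltn_eqF // subr0 /R coefD.
  have -> : (if (n <= d)%N then c *: Q (d - n)%N else 0)`_(t + a * m) = 0.
    case: leqP => nd; last by rewrite coef0.
    rewrite coefZ IHd ?mulr0 //; [lia|lia|].
    have -> : (N - (d - n + n) = N - d)%N by lia.
    by rewrite aq; exact: low_lt.
  have tam : (t + a * m < p ^ (N - d))%N by rewrite aq; exact: low_lt.
  move=> /(_ tam); rewrite add0r GE mulrA coefMXn ltnNge leq_addl /= addnK.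
  by rewrite mulrDr mulr1 coefD coefMXn tq add0r.
(* In degree [D] the constant term should be 1, but the top part contributes 0 by [Qlow] and the
   bottom part is divisible by X^(am) with m > 0. *)
have := @R0 D 0%N DM (pgt0 _); rewrite eqxx /R coefB coefD.
have -> : (if (n <= D)%N then c *: Q (D - n)%N else 0)`_0 = 0.
  case: leqP => nD; last by rewrite coef0.
  by rewrite coefZ Qlow ?mulr0 // ltn_subrL n_gt0 (leq_trans n_gt0).
rewrite GE mulrA coefMXn muln_gt0 pgt0 m_gt0 /= add0r coef1 sub0r => /eqP.
by rewrite oppr_eq0 oner_eq0.
Qed.
End NonZero.

(** * Irreducibility *)

Lemma quot_pi_is_linear (E : fieldType) (G : groupType) (V : rep E G) (w : V) :
  linear (quot_pi w).
Proof. by move=> a u v; rewrite quot_piD -quot_scaleE. Qed.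

HB.instance Definition _ (E : fieldType) (G : groupType) (V : rep E G) (w : V) :=
  GRing.isLinear.Build E V (quot_space w) *:%R (quot_pi w) (@quot_pi_is_linear E G V w).

Theorem theorem1p3p8 (p : nat) (p_pr : prime p) (E : fieldExtType 'F_p)
    (n h : nat) (hn : (2 <= n)%N)
    (h_ge1 : (1 <= h)%N) (h_le : (h <= p ^ n.-1 - 1)%N)
    (h_prim : primitive p n h)
    (sigma1 sigma2 : smooth_char p_pr E)
    (sigma_p : sigma1 p%:R = sigma2 p%:R) :
  irreducible (Pi sigma1 sigma2 n h).
Proof.
have pE : p \in [pchar E] by rewrite (pchar_lalg E) pchar_Fp.
have n0 : (0 < n)%N by apply: leq_trans hn.
have p1 : (0 < p.-1)%N by rewrite -ltnS prednK ?prime_gt1 ?prime_gt0.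
have pgt0 i : (0 < p ^ i)%N by rewrite expn_gt0 prime_gt0.
(* The bound h <= p^(n-1) - 1 enters here; it makes m = q - 1 - h(p-1) positive. *)
have hp_lt : (h * p.-1 < (p ^ n).-1)%N.
  apply: (@leq_ltn_trans ((p ^ n.-1 - 1) * p.-1)); first by rewrite leq_mul2r h_le orbT.
  have -> : (p ^ n = p.-1 * p ^ n.-1 + p ^ n.-1)%N.
    by rewrite -mulSnr prednK ?prime_gt0 // -expnS prednK.
  rewrite mulnBl mul1n [(p ^ _ * _)%N]mulnC.
  have b0 : (0 < p.-1 * p ^ n.-1)%N by rewrite muln_gt0 p1 pgt0.
  have a0 := pgt0 n.-1; move: (p ^ n.-1)%N (p.-1 * p ^ n.-1)%N b0 a0 => a b b0 a0; lia.
pose m := ((p ^ n).-1 - h * p.-1)%N.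
have mE : (m + h * p.-1 = (p ^ n).-1)%N by rewrite subnK // ltnW.
have m0 : (0 < m)%N by rewrite subn_gt0.
have m_lt : (m < (p ^ n).-1)%N by rewrite -mE -addn1 leq_add2l muln_gt0 h_ge1.
have m_dvd : (p.-1 %| m)%N.
  have : (p.-1 %| (p ^ n).-1)%N by exact: dvdn_pred_predX.
  by rewrite -mE dvdn_addl // dvdn_mull.
pose c : E := (- (sigma1 p%:R)^-1) ^+ n.
have c0 : c != 0.
  rewrite expf_neq0 // oppr_eq0 invr_eq0 schar_neq0 //.
  exact: padic_p_neq0.
have wE : S_generator sigma1 sigma2 n h = rel_elt sigma1 sigma2 n m c.
  by rewrite S_generatorE // (ltn_trans hp_lt) // prednK.
rewrite /Pi wE; set w := rel_elt _ _ _ _ _.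
pose I := ind_rep sigma1 sigma2; pose e : I := bracket sigma1 sigma2 1%g.
pose V := quot_rep w; pose pi : {linear I -> V} := quot_pi w.
have piE g v : rep_act g (pi v) = pi (rep_act g v) := quot_actE w g v.
have eK k : borel_KZ k -> rep_act k (pi e) = sigma sigma1 sigma2 k *: pi e.
  by move=> kK; rewrite piE bracket_K // linearZ.
split.
  exists (pi e); apply/eqP => pe0.
  have /quot_piP : quot_pi w e = quot_pi w 0 by rewrite [RHS](linear0 pi).
  rewrite subr0; apply/negP; apply: e_notin_translates => //.
  by rewrite (ltn_trans m_lt) // ltn_predL pgt0.
move=> W W_submod W_stable.
have e_E d : pi (level_vec e d) = level_vec (pi e) d by rewrite /level_vec piE.
have relE : pi w = c *: level_vec (pi e) n + rep_act (unip (p%:R ^- n))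
    (pact (dif (V := V) (p%:R ^- n)) 'X^m (level_vec (pi e) 0)).
  rewrite -!e_E -(@pact_morph _ I V (dif (p%:R ^- n)) _ pi) => [|u].
    by rewrite piE -linearZ -linearD.
  by rewrite /dif linearB -piE.
(* The generator [w] dies in the quotient; solving for the level vector n gives the tower relation
   with constant -c^-1. *)
have rel : level_vec (pi e) n = - c^-1 *: rep_act (unip (p%:R ^- n))
    (pact (dif (V := V) (p%:R ^- n)) 'X^m (level_vec (pi e) 0)).
  have pw0 : pi w = 0.
    rewrite -(linear0 pi); apply/quot_piP; rewrite subr0; apply/asboolP.
    by exists [:: (1, 1%g)]; rewrite big_seq1 scale1r rep_act1.
  apply: (scalerI c0); rewrite scalerA mulrN mulfV // scaleN1r; apply/eqP.
  by rewrite -addr_eq0 -relE pw0.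
apply: (stable_submodule_trivial eK pE n0 m0 h_prim mE m_lt _ rel) => //.
  by rewrite oppr_eq0 invr_eq0.
move=> v; have [s sE] := ind_generated (repr v : I).
exists s; rewrite -[LHS]quot_reprP sE -[LHS]/(pi _) linear_sum.
by apply: eq_bigr => a _; rewrite linearZ piE.
Qed.
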